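(* Let $\{(X(t),Y(t))\}_{t\ge0}$ be a reflecting orthogonal planar random motion with speed $c>0$ whose changes of direction are governed by a Poisson process $\{N(t)\}_{t\ge0}$ with rate function $\lambda(t)\in C^1\bigl((0,\infty),[0,\infty)\bigr)$ such that $\int_0^t\lambda(s)\,ds<\infty$ for all $t>0$. Put $$U(t)=\frac{X(t)+Y(t)}2,\qquad V(t)=\frac{X(t)-Y(t)}2.$$ Then $\{U(t)\}_{t\ge0}$ and $\{V(t)\}_{t\ge0}$ are two (dependent) one-dimensional telegraph processes with rate function $2\lambda(t)/3$ and velocity $c/2$, and the Poisson processes $N^{(U)}$ and $N^{(V)}$, of rate function $2\lambda(t)/3$, governing the changes of velocity of $U$ and $V$ respectively, can be written, for $t\ge0$, as $$N^{(U)}(t)=N_U(t)+\tilde N(t),\qquad N^{(V)}(t)=N_V(t)+\tilde N(t),$$ where $\{N_U(t)\}_{t\ge0}$, $\{N_V(t)\}_{t\ge0}$ and $\{\tilde N(t)\}_{t\ge0}$ are three independent Poisson processes with rate function $\lambda(t)/3$. Moreover $N(t)=N_U(t)+N_V(t)+\tilde N(t)$ almost surely.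
   Context: Directions: $d_k=(\cos(k\pi/2),\sin(k\pi/2))$, $k=0,1,2,3$, with indices taken modulo 4. The reflecting orthogonal planar random motion with speed $c$ and rate function $\lambda$ is the position $(X(t),Y(t))$ of a particle that starts at the origin at time $0$ with initial direction uniformly distributed on $\{d_0,d_1,d_2,d_3\}$, moves with velocity $c\,d_k$ as long as its current direction is $d_k$, and at each event of $N$ switches from its current direction $d_k$ to one of the other three directions, each with probability $1/3$ (independently of everything else). A one-dimensional (symmetric) telegraph process with velocity $v>0$ and rate function $\mu(t)$ is the position of a particle on $\mathbb{R}$ starting at $0$ with initial velocity $+v$ or $-v$, each with probability $1/2$, and reversing its velocity at each event of a non-homogeneous Poisson process, independent of the initial velocity, with rate function $\mu(t)$.
   Formalization: The claim that U and V are dependent is stated only when the rate function λ is not identically zero on (0,∞); for λ ≡ 0 the two processes are independent, so the unconditional claim fails there. *)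

(* Defs.v *)
From HB Require Import structures.
From mathcomp Require Import all_boot all_order all_algebra.
From mathcomp Require Import all_classical all_reals all_analysis.

Set Implicit Arguments.
Unset Strict Implicit.
Unset Printing Implicit Defensive.
Import Order.TTheory GRing.Theory Num.Theory.
Import numFieldTopology.Exports numFieldNormedType.Exports.
Local Open Scope classical_set_scope.
Local Open Scope ring_scope.

HB.instance Definition _ n := isPointed.Build 'I_n.+1 ord0.
HB.instance Definition _ n := @isMeasurable.Build default_measure_display
  'I_n.+1 discrete_measurable discrete_measurable0
  discrete_measurableC discrete_measurableU.

Section Independence.
Context d (T : measurableType d) (R : realType) (P : probability T R).

Definition mutually_independent (I : finType) (F : I -> set_system T) : Prop :=
  forall (J : {set I}) (A : I -> set T), (forall i, i \in J -> F i (A i)) ->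
    (P (\bigcap_(i in [set` J]) A i) = \prod_(i in J) P (A i))%E.

Definition sigma_var d' (E : measurableType d') (Z : T -> E) : set_system T :=
  preimage_set_system setT Z measurable.

Definition sigma_family d' (E : measurableType d') (I : Type) (J : set I)
    (Z : I -> T -> E) : set_system T :=
  <<s \bigcup_(i in J) sigma_var (Z i) >>.

(* Processes have index type R but only times t >= 0 matter. *)
Definition sigma_process d' (E : measurableType d') (Z : R -> T -> E) :
    set_system T :=
  sigma_family [set t | 0 <= t] Z.

End Independence.

Section Processes.
Context d (T : measurableType d) (R : realType) (P : probability T R).

Definition C1_nonneg_rate (lam : R -> R) : Prop :=
  [/\ forall t, 0 < t -> 0 <= lam t,
      forall t, 0 < t -> derivable lam t 1 &
      forall t, 0 < t -> {for t, continuous (derive1 lam)}].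

Definition cumulative_rate (lam : R -> R) (s t : R) : R :=
  \int[lebesgue_measure]_(u in `]s, t]) lam u.

(* The second argument of the library's poisson_prob is a dummy; for a zero
   parameter this measure is the Dirac mass at 0. *)
Record poisson_process (lam : R -> R) (N : R -> T -> nat) : Prop := {
  poisson_measurable : forall t, 0 <= t -> measurable_fun setT (N t);
  poisson_start : forall w, N 0 w = 0%N;
  poisson_nondecreasing : forall w s t, 0 <= s -> s <= t ->
    (N s w <= N t w)%N;
  poisson_right_continuous : forall w t, 0 <= t -> N ^~ w @ t^'+ --> N t w;
  poisson_indep_increments : forall (n : nat) (t : nat -> R),
    0 <= t 0%N -> (forall i, t i <= t i.+1) ->
    mutually_independent P (fun i : 'I_n =>
      sigma_var (fun w => (N (t i.+1) w - N (t i) w)%N));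
  poisson_law_increments : forall s t (B : set nat), 0 <= s -> s <= t ->
    P [set w | B (N t w - N s w)%N] =
    poisson_prob (cumulative_rate lam s t) 0%N B
}.

Definition direction (k : 'I_4) : R * R :=
  (cos (k%:R * pi / 2), sin (k%:R * pi / 2)).

(* D n is the direction after the n-th event of N, so that the direction at
   time s is D (N s); the conditional probabilities of the switches are written
   as products. *)
Record reflecting_motion (c : R) (N : R -> T -> nat) (D : nat -> T -> 'I_4)
    (X Y : R -> T -> R) : Prop := {
  direction_measurable : forall n, measurable_fun setT (D n);
  direction_initial : forall k, P (D 0%N @^-1` [set k]) = (4^-1)%:E;
  direction_initial_indep :
    mutually_independent P (tnth [tuple sigma_var (D 0%N); sigma_process N]);
  direction_switch : forall n (k j : 'I_4) (A : set T), j != k ->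
    <<s sigma_process N `|` sigma_family [set i | (i <= n)%N] D >> A ->
    P (A `&` D n @^-1` [set k] `&` D n.+1 @^-1` [set j]) =
    ((3^-1)%:E * P (A `&` D n @^-1` [set k]))%E;
  motion_abscissa : forall t w, 0 <= t ->
    X t w = \int[lebesgue_measure]_(s in `[0, t])
              (c * (direction (D (N s w) w)).1);
  motion_ordinate : forall t w, 0 <= t ->
    Y t w = \int[lebesgue_measure]_(s in `[0, t])
              (c * (direction (D (N s w) w)).2)
}.

(* U is the telegraph process with velocity v and rate function mu whose
   velocity reversals are the events of M. *)
Definition telegraph_process (v : R) (mu : R -> R) (M : R -> T -> nat)
    (U : R -> T -> R) : Prop :=
  poisson_process mu M /\
  exists V0 : T -> R,
    [/\ measurable_fun setT V0,
        P (V0 @^-1` [set v]) = (2^-1)%:E /\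
          P (V0 @^-1` [set - v]) = (2^-1)%:E,
        mutually_independent P (tnth [tuple sigma_var V0; sigma_process M]) &
        forall t w, 0 <= t ->
          U t w = \int[lebesgue_measure]_(s in `[0, t])
                    (V0 w * (-1) ^+ M s w)].

End Processes.

(* Main.v *)
Require Import Defs.
From HB Require Import structures.
From mathcomp Require Import all_boot all_order all_algebra.
From mathcomp Require Import all_classical all_reals all_analysis.
From mathcomp Require Import measurable_realfun.
From mathcomp Require Import ring lra zify.
Import Order.TTheory GRing.Theory Num.Theory.
Import numFieldTopology.Exports numFieldNormedType.Exports.
Local Open Scope classical_set_scope.
Local Open Scope ring_scope.

Set Implicit Arguments.
Unset Strict Implicit.
Unset Printing Implicit Defensive.

(** A direction is determined by the pair of signs of the velocities of
    [U = (X + Y) / 2] and [V = (X - Y) / 2], and every pair of signs occurs: for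
    both processes the speed is always [c / 2].  A switch of the particle
    therefore flips the sign of [U] only, of [V] only, or of both, and these three
    possibilities are equally likely, whatever happened before.  So the switches
    are the events of [N] coloured independently, with three equally likely
    colours; [N_U], [N_V] and the common part count the events of each colour, and
    the velocity of [U] at time [t] is its initial value times [-1] to the power
    [N_U + Nt].  Everything except the dependence of [U] and [V] is the colouring
    theorem of Poisson processes, [thinning_independent] and [thinning_poisson]:
    the counts of the colours are independent Poisson processes, jointly
    independent of the initial direction.

    The colouring theorem is used with two colourings.  The pair (does [U] turn,
    does [V] turn) gives the three independent processes; its fourth value, no
    turn, has weight [0], so that [N] is almost surely the sum of the three others
    while the velocity formulas hold for every outcome.  The bit (does [U] turn)
    alone, with weights [2/3] and [1/3], shows directly that [N_U + Nt] is a Poisson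
    process that is independent of the initial velocity; likewise for [V].

    The colouring theorem is proved on a finite grid of times starting at [0].
    Given the increments of [N], the numbers of events of each colour in the
    successive intervals are independent multinomial vectors ([block_law],
    [blocks_law]), and a Poisson probability times a multinomial one factors into
    Poisson probabilities ([multinomial_poisson]).  Hence the increments of all
    colours are mutually independent ([increments_independent]); grouping them by
    colour gives the independence of events that depend on finitely many times,
    and these form pi-systems generating the sigma-algebras of the processes.

    For the dependence, let [L] be the cumulative rate on [0, t].  If the particle
    starts in direction [0] and has no event before [t], then [U] and [V] both
    reach [c / 2 * t], so this has probability at least [exp (- L) / 4].  But [U]
    reaches [c / 2 * t] only if it starts with a positive velocity and has an even
    number of reversals at every time before [t], in particular not exactly one;
    for small [L] this bounds the probability that independence would give by
    about [(1 - 2 L / 3) ^ 2 / 4], which is smaller than [exp (- L) / 4]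
    ([coordinates_dependent]). *)

(** * Independence of sigma-algebras *)

Section IndependenceOfGenerated.
Context d (T : measurableType d) (R : realType) (P : probability T R).

(** The events [B] with [P (E `&` B) = P E * P B] form a Dynkin system. *)
Lemma g_sigma_algebra_independent_event (G : set_system T) (E : set T) :
  setI_closed G -> G `<=` measurable -> measurable E ->
  (forall B, G B -> P (E `&` B) = (P E * P B)%E) ->
  forall B, <<s G >> B -> P (E `&` B) = (P E * P B)%E.
Proof.
move=> GI Gm mE Gind.
pose H := [set B | measurable B /\ P (E `&` B) = (P E * P B)%E].
suff: <<s G >> `<=` H by move=> GH B /GH[].
rewrite -setI_closed_g_dynkin_g_sigma_algebra//; apply: smallest_sub.
- split.
  + by split; [exact: measurableT|rewrite setIT probability_setT mule1].
  + move=> B [mB PB]; split; first exact: measurableC.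
    have -> : P (E `&` ~` B) = (P E - P (E `&` B))%E.
      by rewrite -setDE measureD// ltey_eq fin_num_measure.
    have -> : P (~` B) = (1 - P B)%E by rewrite probability_setC.
    rewrite PB; have : P B \is a fin_num by rewrite fin_num_measure.
    have : P E \is a fin_num by rewrite fin_num_measure.
    case: (P E) (P B) => [e||] [b||] // _ _.
    by congr EFin; ring.
  + move=> F tF FH; split; first by apply: bigcupT_measurable => k; have [] := FH k.
    have mF k : measurable (F k) by have [] := FH k.
    have mEF k : measurable (E `&` F k) by exact: measurableI.
    rewrite setI_bigcupr (measure_bigcup P setT F)// measure_bigcup//; last first.
      exact: trivIset_setIl.
    have PE : P E = (fine (P E))%:E by rewrite fineK ?fin_num_measure.
    rewrite PE -nneseriesZl -?PE; last by move=> *; exact: measure_ge0.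
    by apply: eq_eseriesr => k _; have [] := FH k.
- by move=> B GB; split; [exact: Gm|exact: Gind].
Qed.

Lemma bigcap_set_measurable (I : finType) (J : {set I}) (A : I -> set T) :
  (forall i, i \in J -> measurable (A i)) ->
  measurable (\bigcap_(i in [set` J]) A i).
Proof. by move=> mA; exact: fin_bigcap_measurable. Qed.

Lemma mutually_independent_sub (I : finType) (F G : I -> set_system T) :
  (forall i, F i `<=` G i) -> mutually_independent P G ->
  mutually_independent P F.
Proof. by move=> FG indG J A FA; apply: indG => i iJ; exact/FG/FA. Qed.

(** One index at a time: for a fixed choice of the other events, their
    intersection is an event independent of the pi-system at [i0]. *)
Lemma mutually_independent_generated1 (I : finType) (F : I -> set_system T)
    (i0 : I) :
  (forall i, F i `<=` measurable) -> setI_closed (F i0) ->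
  mutually_independent P F ->
  mutually_independent P (fun i => if i == i0 then <<s F i >> else F i).
Proof.
move=> Fm FI indF J A FA.
have [i0J|i0J] := boolP (i0 \in J); last first.
  apply: indF => i iJ; have := FA i iJ; case: eqP => // ii0.
  by rewrite -ii0 iJ in i0J.
have split_i0 (B : I -> set T) : \bigcap_(i in [set` J]) B i =
    (\bigcap_(i in [set` (J :\ i0)%SET]) B i) `&` B i0.
  apply/seteqP; split => w /=.
    move=> Bw; split; last exact: Bw.
    by move=> i /=; rewrite !inE => /andP[_ iJ]; exact: Bw.
  move=> [Bw Bi0] i /= iJ; have [->//|ii0] := eqVneq i i0.
  by apply: Bw; rewrite /= !inE ii0.
have FJ i : i \in (J :\ i0)%SET -> F i (A i).
  by rewrite !inE => /andP[/negPf ii0 /FA]; rewrite ii0.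
rewrite split_i0 (big_setD1 i0)//= muleC -(indF (J :\ i0)%SET)//.
apply: (@g_sigma_algebra_independent_event (F i0)) => //.
- by apply: bigcap_set_measurable => i /FJ/Fm.
- move=> B FB; pose A' i := if i == i0 then B else A i.
  have A'0 : A' i0 = B by rewrite /A' eqxx.
  have A'A i : i \in (J :\ i0)%SET -> A' i = A i.
    by rewrite !inE /A' => /andP[/negPf ->].
  have := indF J A'; rewrite split_i0 (big_setD1 i0)//= A'0 muleC.
  rewrite (eq_bigcapr A'A) (eq_bigr _ (fun i iJ => congr1 P (A'A i iJ))).
  rewrite -indF// => -> // i iJ.
  have [->|ii0] := eqVneq i i0; first by rewrite A'0.
  have iJ0 : i \in (J :\ i0)%SET by rewrite !inE ii0.
  by rewrite A'A //; exact: FJ.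
- by have := FA _ i0J; rewrite eqxx.
Qed.

Lemma mutually_independent_generated (I : finType) (F : I -> set_system T) :
  (forall i, F i `<=` measurable) -> (forall i, setI_closed (F i)) ->
  mutually_independent P F -> mutually_independent P (fun i => <<s F i >>).
Proof.
move=> Fm FI indF.
have sFm i : <<s F i >> `<=` measurable.
  by apply: smallest_sub => //; exact: sigma_algebra_measurable.
suff H (s : seq I) :
    mutually_independent P (fun i => if i \in s then <<s F i >> else F i).
  apply: mutually_independent_sub (H (enum I)) => i A.
  by rewrite mem_enum.
elim: s => [|i0 s IH]; first by apply: mutually_independent_sub indF => i A.
have [i0s|i0s] := boolP (i0 \in s).
  apply: mutually_independent_sub IH => i A.
  by rewrite inE; case: eqP => // ->; rewrite i0s.
apply: mutually_independent_sub (mutually_independent_generated1 (i0 := i0) _ _ IH).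
- move=> i A; rewrite in_cons; case: eqP => [->|_] //=.
  by rewrite (negPf i0s).
- by move=> i; case: ifP => _; [exact: sFm|exact: Fm].
- by rewrite (negPf i0s); exact: FI.
Qed.

(** Independence survives grouping the indices along [h]: the intersections of
    events taken from one group form a pi-system, and the product formula over
    groups is the one over indices. *)
Lemma mutually_independent_grouped (I K : finType) (h : I -> K)
    (F : I -> set_system T) :
  (forall i, F i `<=` measurable) -> (forall i, setI_closed (F i)) ->
  mutually_independent P F ->
  mutually_independent P (fun k => <<s [set A | exists2 B : I -> set T,
    (forall i, h i = k -> F i (B i)) & A = \bigcap_(i in [set i | h i = k]) B i] >>).
Proof.
move=> Fm FI indF; apply: mutually_independent_generated.
- move=> k _ [B FB ->]; 
  rewrite (_ : [set i | h i = k] = [set` [set i | h i == k]%SET]); last first.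
    by apply/seteqP; split=> i /=; rewrite inE => /eqP.
  by apply: bigcap_set_measurable => i; rewrite inE => /eqP/FB/Fm.
- move=> k _ _ [B FB ->] [C FC ->]; exists (fun i => B i `&` C i).
    by move=> i hi; apply: FI; [exact: FB|exact: FC].
  by rewrite bigcapI.
- move=> J A FA.
  have /choice[B BP] : forall k, exists B : I -> set T, k \in J ->
      (forall i, h i = k -> F i (B i)) /\ A k = \bigcap_(i in [set i | h i = k]) B i.
    move=> k; have [/FA[B FB ->]|kJ] := boolP (k \in J); first by exists B.
    by exists (fun=> set0).
  have indh (L : {set K}) : L \subset J ->
      P (\bigcap_(i in [set` [set i | h i \in L]%SET]) B (h i) i)
      = (\prod_(i | h i \in L) P (B (h i) i))%E.
    move=> /fintype.subsetP LJ; rewrite indF; first by apply: eq_bigl => i; rewrite inE.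
    by move=> i; rewrite inE => /LJ/BP[+ _]; apply.
  have -> : \bigcap_(k in [set` J]) A k =
      \bigcap_(i in [set` [set i | h i \in J]%SET]) B (h i) i.
    apply/seteqP; split => w /=.
      move=> Aw i /=; rewrite inE => hiJ; have := Aw _ hiJ.
      by have [_ ->] := BP _ hiJ; exact.
    move=> Bw k kJ; have [_ ->] := BP _ kJ => i /= hik.
    by rewrite -hik; apply: Bw; rewrite /= inE hik.
  rewrite indh// (partition_big h (mem J))//=; apply: eq_bigr => k kJ.
  have [_ ->] := BP _ kJ.
  rewrite (_ : \bigcap_(i in _) B k i =
      \bigcap_(i in [set` [set i | h i \in [set k]%SET]%SET]) B (h i) i); last first.
    apply/seteqP; split => w /= Bw i /=.
      by rewrite !inE => /eqP hik; rewrite hik; exact: Bw.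
    by move=> hik; have := Bw i; rewrite /= !inE hik eqxx; exact.
  rewrite indh; last by rewrite finset.sub1set.
  by apply: eq_bigl => i; rewrite !inE; case: eqP => [->|]; rewrite ?kJ ?andbF.
Qed.

End IndependenceOfGenerated.

(** * Joint laws of families of integer variables *)

Lemma big_option (V : Type) (idx : V) (op : Monoid.com_law idx) (I : finType)
    (f : option I -> V) :
  \big[op/idx]_o f o = op (f None) (\big[op/idx]_i f (Some i)).
Proof.
rewrite (bigD1 None)//=; congr (op _ _).
rewrite (reindex_omap (Some : I -> option I) id) /=; last by case.
by apply: eq_bigl => i; rewrite eqxx.
Qed.

Section DiscreteJointLaw.
Context d (T : measurableType d) (R : realType) (P : probability T R).

Lemma discrete_law_singletons (E : set T) (Z : T -> nat)
    (m : probability nat R) (c : R) :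
  measurable E -> measurable_fun setT Z ->
  (forall x, P (E `&` Z @^-1` [set x]) = (c%:E * m [set x])%E) ->
  forall B, P (E `&` Z @^-1` B) = (c%:E * m B)%E.
Proof.
move=> mE mZ PZ B.
have mZx x : measurable (E `&` Z @^-1` [set x]).
  by apply: measurableI => //; rewrite -[_ @^-1` _]setTI; exact: mZ.
have -> : E `&` Z @^-1` B = \bigcup_(x in B) (E `&` Z @^-1` [set x]).
  apply/seteqP; split=> [w [Ew Bw]|w [x Bx [Ew wx]]]; first by exists (Z w).
  by split=> //=; rewrite wx.
rewrite measure_bigcup//; last first.
  by move=> x y _ _ [w [[_ /= wx] [_ /= wy]]]; rewrite -wx wy.
have {2}-> : B = \bigcup_(x in B) [set x].
  by apply/seteqP; split=> [x Bx|_ [x Bx ->]//]; exists x.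
rewrite measure_bigcup//; last first.
  by move=> x y _ _ [w [/= -> ->]].
by rewrite -nneseriesZl//; apply: eq_eseriesr => x _; exact: PZ.
Qed.

(** A joint law given by a product on points is a product on boxes: singletons
    are replaced by arbitrary sets one coordinate at a time, by countable
    additivity in that coordinate. *)
Lemma joint_law_sets (I : finType) (E : set T) (Z : I -> T -> nat)
    (m : I -> probability nat R) :
  measurable E -> (forall i, measurable_fun setT (Z i)) ->
  (forall x : I -> nat, P (E `&` \bigcap_i (Z i @^-1` [set x i])) =
     (P E * \prod_i m i [set x i])%E) ->
  forall B : I -> set nat, P (E `&` \bigcap_i (Z i @^-1` B i)) =
     (P E * \prod_i m i (B i))%E.
Proof.
move=> mE mZ PZ.
suff H (s : seq I) (B : I -> set nat) :
    (forall i, i \notin s -> exists x, B i = [set x]) ->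
    P (E `&` \bigcap_i (Z i @^-1` B i)) = (P E * \prod_i m i (B i))%E.
  by move=> B; apply: (H (enum I)) => i; rewrite mem_enum.
elim: s B => [|i0 s IH] B B1.
  have /choice[x Bx] : forall i, exists x, B i = [set x] by move=> i; exact: B1.
  by have -> : B = fun i => [set x i] by apply/funext.
(* The family B with its value at i0 replaced by a point. *)
pose B' x i := if i == i0 then [set x] else B i.
have split_i0 (C : I -> set nat) : E `&` \bigcap_i (Z i @^-1` C i) =
    (E `&` \bigcap_(i in [set` [set~ i0]%SET]) (Z i @^-1` C i)) `&` Z i0 @^-1` C i0.
  rewrite -setIA; congr (_ `&` _); apply/seteqP; split => w /=.
    by move=> Cw; split => [i _|]; exact: Cw.
  move=> [Cw C0] i _; have [->//|ii0] := eqVneq i i0.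
  by apply: Cw; rewrite /= !inE.
have mZB i (C : set nat) : measurable (Z i @^-1` C).
  by rewrite -[_ @^-1` _]setTI; exact: mZ.
pose c := fine (P E * \prod_(i | i != i0) m i (B i))%E.
have cE : c%:E = (P E * \prod_(i | i != i0) m i (B i))%E.
  rewrite fineK// fin_numM ?fin_num_measure//.
  by apply: prode_fin_num => i _; rewrite fin_num_measure.
rewrite split_i0 (bigD1 i0)//= muleCA muleC -cE.
apply: discrete_law_singletons => //.
  by apply: measurableI => //; apply: bigcap_set_measurable => i _; exact: mZB.
move=> x; have B'0 : B' x i0 = [set x] by rewrite /B' eqxx.
have B'B i : i != i0 -> B' x i = B i by rewrite /B' => /negPf ->.
have := IH (B' x); rewrite split_i0 (bigD1 i0)//= B'0 muleCA muleC.
rewrite (eq_bigr _ (fun i ii0 => congr1 (m i) (B'B i ii0))) -cE => <-.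
  congr (P (_ `&` _ `&` _)); apply: eq_bigcapr => i.
  by rewrite /= !inE => ii0; rewrite B'B.
move=> i si; have [->|ii0] := eqVneq i i0; first by exists x.
by rewrite B'B//; apply: B1; rewrite inE negb_or ii0.
Qed.

(** The index [None] stands for the events of [E0], which need not come from an
    integer variable; taking the sure event there gives the laws of the [Z i]. *)
Lemma mutually_independent_joint_law (I : finType) (E0 : set_system T)
    (Z : I -> T -> nat) (m : I -> probability nat R) :
  E0 setT -> E0 `<=` measurable ->
  (forall i, measurable_fun setT (Z i)) ->
  (forall E, E0 E -> forall x : I -> nat,
    P (E `&` \bigcap_i (Z i @^-1` [set x i])) =
     (P E * \prod_i m i [set x i])%E) ->
  (forall i B, P (Z i @^-1` B) = m i B) /\
  mutually_independent P
    (fun o : option I => if o is Some i then sigma_var (Z i) else E0).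
Proof.
move=> E0T E0m mZ PZ.
have PZB E (EE : E0 E) B := joint_law_sets (E0m _ EE) mZ (PZ E EE) B.
have law i B : P (Z i @^-1` B) = m i B.
  have := PZB _ E0T (fun j => if j == i then B else setT).
  rewrite setTI probability_setT mul1e (bigD1 i)//= eqxx big1 ?mule1; last first.
    by move=> j /negPf ->; rewrite probability_setT.
  move=> <-; congr (P _); apply/seteqP; split => w /=.
    by move=> Bw j _; case: eqP => [->|].
  by move=> /(_ i Logic.I) /=; rewrite eqxx.
split=> // J A FA.
have /choice[B BP] : forall i, exists B : set nat,
    (Some i \in J -> A (Some i) = Z i @^-1` B) /\
    (Some i \notin J -> B = setT).
  move=> i; have [iJ|iJ] := boolP (Some i \in J); last by exists setT.
  by have [B _ <-] := FA _ iJ; exists B; split => // _; rewrite setTI.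
pose E := if None \in J then A None else setT.
have EE : E0 E by rewrite /E; case: ifP => // /FA.
transitivity (P (E `&` \bigcap_i (Z i @^-1` B i))).
  congr (P _); apply/seteqP; split => w /=.
    move=> Aw; split; first by rewrite /E; case: ifP => // NJ; exact: Aw.
    move=> i _; have [iJ|iJ] := boolP (Some i \in J).
      by have := Aw (Some i) iJ; have [-> //] := BP i.
    by have [_ ->] := BP i.
  move=> [Ew Bw] [i|] /= oJ; last by move: Ew; rewrite /E oJ.
  by have [-> // _] := BP i; exact: Bw.
rewrite PZB// [RHS]big_mkcond/= big_option /=.
congr (_ * _)%E.
  by rewrite /E; case: ifP => // _; rewrite probability_setT.
apply: eq_bigr => i _; rewrite -law; case: ifPn => iJ; have [B1 B2] := BP i.
  by rewrite B1.
by rewrite B2// preimage_setT probability_setT.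
Qed.

End DiscreteJointLaw.

(** The product formula for [J] is the one for its image [h @: J]. *)
Lemma mutually_independent_inj d (T : measurableType d) (R : realType)
    (P : probability T R) (I K : finType) (h : I -> K) (F : K -> set_system T)
    (G : I -> set_system T) :
  injective h -> (forall i, G i `<=` F (h i)) ->
  mutually_independent P F -> mutually_independent P G.
Proof.
move=> hinj GF indF J A GA.
have [->|[i0 i0J]] := set_0Vmem J.
  rewrite big_set0 (_ : \bigcap_(_ in _) _ = setT) ?probability_setT//.
  by apply/seteqP; split => // w _ i /=; rewrite inE.
pose A' k := A (odflt i0 [pick i | h i == k]).
have A'h i : A' (h i) = A i.
  rewrite /A'; case: pickP => [j /eqP/hinj -> //|/(_ i)].
  by rewrite eqxx.
have := indF (h @: J)%SET A'; rewrite big_imset/=; last by move=> i j _ _ /hinj.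
rewrite (eq_bigr _ (fun i _ => congr1 P (A'h i))) => <-.
  congr (P _); apply/seteqP; split => w /= Aw i /=.
    by move=> /imsetP[j jJ ->]; rewrite A'h; exact: Aw.
  by move=> iJ; have := Aw (h i); rewrite A'h /= imset_f//; exact.
by move=> k /imsetP[i iJ ->]; rewrite A'h; exact/GF/GA.
Qed.

(** * Discrete variables relative to a sigma-algebra *)

Lemma measure_fin_partition d (T : measurableType d) (R : realType)
    (P : probability T R) (K : finType) (Z : T -> K) (A : set T) :
  measurable A -> (forall k, measurable (Z @^-1` [set k])) ->
  P A = (\sum_k P (A `&` Z @^-1` [set k]))%E.
Proof.
move=> mA mZ.
have mAZ k : measurable (A `&` Z @^-1` [set k]) by exact: measurableI.
have {1}-> : A = \bigcup_(k in [set: K]) (A `&` Z @^-1` [set k]).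
  by apply/seteqP; split => [w Aw|w [k _ []]//]; exists (Z w).
rewrite measure_fin_bigcup//.
  rewrite (fsbigE (index_enum K)) ?index_enum_uniq//.
    by apply: eq_bigl => k; rewrite mem_setT.
  by move=> k _; rewrite mem_index_enum.
  exact: finite_finset.
by move=> k l _ _ [w [[_ wk] [_ wl]]]; rewrite -wk -wl.
Qed.

Section DiscreteVariables.
Context (T : Type) (G : set_system T).
Hypothesis sG : sigma_algebra setT G.

(** Measurability with respect to a set system [G] that is not attached to the
    type [T], for variables whose values carry the discrete sigma-algebra. *)
Definition discrete_variable (V : Type) (Z : T -> V) := forall B, G (Z @^-1` B).

Lemma discrete_variable_comp (V W : Type) (f : V -> W) (Z : T -> V) :
  discrete_variable Z -> discrete_variable (f \o Z).
Proof. by move=> dZ B; exact: (dZ (f @^-1` B)). Qed.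

Lemma sigma_algebra_countable_cup (V : countType) (B : set V) (A : V -> set T) :
  (forall v, B v -> G (A v)) -> G (\bigcup_(v in B) A v).
Proof.
move=> GA; have [G0 _ GU] := sG.
pose A' n := if unpickle n is Some v then if v \in B then A v else set0 else set0.
have -> : \bigcup_(v in B) A v = \bigcup_n A' n.
  apply/seteqP; split => w.
    by move=> [v Bv Aw]; exists (pickle v) => //; rewrite /A' pickleK mem_set.
  move=> [n _]; rewrite /A'; case: unpickle => // v.
  by case: ifPn => // /set_mem Bv Aw; exists v.
apply: GU => n; rewrite /A'; case: unpickle => // v.
by case: ifPn => // /set_mem/GA.
Qed.

Lemma sigma_algebra_cap A B : G A -> G B -> G (A `&` B).
Proof.
move=> GA GB; have [G0 GC GU] := sG.
have GU2 X Y : G X -> G Y -> G (X `|` Y).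
  move=> GX GY; have -> : X `|` Y = \bigcup_b (if b then X else Y).
    apply/seteqP; split => [w [Xw|Yw]|w [[] _ Xw]].
    - by exists true.
    - by exists false.
    - by left.
    - by right.
  by apply: sigma_algebra_countable_cup => -[].
rewrite -[_ `&` _]setCK -setTD setCI; apply: (GC).
by apply: GU2; rewrite -setTD; exact: GC.
Qed.

Lemma discrete_variable_countable (V : countType) (Z : T -> V) :
  (forall v, G (Z @^-1` [set v])) -> discrete_variable Z.
Proof.
move=> GZ B; have -> : Z @^-1` B = \bigcup_(v in B) (Z @^-1` [set v]).
  by apply/seteqP; split => [w Bw|w [v Bv /= ->]//]; exists (Z w).
exact: sigma_algebra_countable_cup.
Qed.

(** A process taken at a random index: split along the countably many values of
    the index. *)
Lemma discrete_variable_index (V W : countType) (M : T -> V) (Z : V -> T -> W) :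
  discrete_variable M -> (forall v, discrete_variable (Z v)) ->
  discrete_variable (fun w => Z (M w) w).
Proof.
move=> dM dZ B; have -> : (fun w => Z (M w) w) @^-1` B =
    \bigcup_(v in setT) (M @^-1` [set v] `&` Z v @^-1` B).
  by apply/seteqP; split => [w Bw|w [v _ [/= -> ]]//]; exists (M w).
apply: sigma_algebra_countable_cup => v _; apply: sigma_algebra_cap.
  exact: dM.
exact: dZ.
Qed.

Lemma discrete_variable_pair (V W : countType) (Z1 : T -> V) (Z2 : T -> W) :
  discrete_variable Z1 -> discrete_variable Z2 ->
  discrete_variable (fun w => (Z1 w, Z2 w)).
Proof.
move=> d1 d2; apply: (discrete_variable_index (Z := fun v w => (v, Z2 w))) => // v.
exact: discrete_variable_comp.
Qed.

Lemma discrete_variable_cst (V : Type) (v : V) : discrete_variable (fun=> v).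
Proof.
have [G0 GC _] := sG => B.
have [Bv|Bv] := pselect (B v).
  rewrite (_ : _ @^-1` _ = setT `\` set0); first exact: GC.
  by rewrite setD0; apply/seteqP; split.
by rewrite (_ : _ @^-1` _ = set0) //; apply/seteqP; split.
Qed.

Lemma discrete_variable_ffun (I : finType) (V : countType) (Z : I -> T -> V) :
  (forall i, discrete_variable (Z i)) ->
  discrete_variable (fun w => [ffun i => Z i w]).
Proof.
move=> dZ.
have dmap (s : seq I) : discrete_variable (fun w => [seq Z i w | i <- s]).
  elim: s => [|i s IH] /=; first exact: discrete_variable_cst.
  apply: (discrete_variable_comp (fun x => x.1 :: x.2)
    (Z := fun w => (Z i w, [seq Z j w | j <- s]))).
  exact: discrete_variable_pair.
apply: discrete_variable_countable => f.
have -> : (fun w => [ffun i => Z i w]) @^-1` [set f] =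
    (fun w => [seq Z i w | i <- enum I]) @^-1` [set [seq f i | i <- enum I]].
  apply/seteqP; split => w /=; first by move=> <-; apply: eq_map => i; rewrite ffunE.
  by move=> /eq_in_map e; apply/ffunP => i; rewrite ffunE e// mem_enum.
exact: dmap.
Qed.

End DiscreteVariables.

(** * Multinomial weights and Poisson probabilities *)

Lemma poisson_prob1 (R : realType) (r : R) (k n : nat) : 0 <= r ->
  poisson_prob r k [set n] = (r ^+ n / n`!%:R * expR (- r))%:E.
Proof.
rewrite /poisson_prob le_eqVlt => /predU1P[<-|r0].
  rewrite ltxx diracE oppr0 expR0 mulr1.
  case: n => [|n]; first by rewrite mem_set// expr0 fact0 divr1.
  by rewrite memNset//= expr0n mul0r.
by rewrite r0 esum_set1 ?lee_fin ?poisson_pmf_ge0// /poisson_pmf r0.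
Qed.

(** The probability that [n] independent draws, each of colour [k] with
    probability [p k], contain [x k] draws of colour [k] for every [k]. *)
Definition multinomial_weight (R : realType) (K : finType) (p : K -> R) (n : nat)
    (x : K -> nat) : R :=
  if (\sum_k x k == n)%N then n`!%:R * \prod_k (p k ^+ x k / (x k)`!%:R) else 0.

(** The vector [x] with one draw of colour [l] removed. *)
Definition decr (K : eqType) (l : K) (x : K -> nat) (k : K) : nat := (x k - (k == l))%N.

Lemma sum_decr (K : finType) (l : K) (x : K -> nat) : (0 < x l)%N ->
  (\sum_k x k = (\sum_k decr l x k).+1)%N.
Proof.
move=> xl; rewrite (bigD1 l)//= [in RHS](bigD1 l)//= {1}/decr eqxx subn1.
rewrite -addSn prednK//; congr addn; apply: eq_bigr => k /negPf kl.
by rewrite /decr kl subn0.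
Qed.

Lemma multinomial_weight0 (R : realType) (K : finType) (p : K -> R) (x : K -> nat) :
  multinomial_weight p 0 x = [forall k, x k == 0%N]%:R.
Proof.
rewrite /multinomial_weight sum_nat_eq0; case: ifP => // /forallP x0; rewrite fact0 mul1r big1// => k _.
by rewrite (eqP (x0 k)) expr0 fact0 divr1.
Qed.

(** Conditioning on the colour of the last draw; algebraically, [n.+1] is the sum
    of the [x k]. *)
Lemma multinomial_weightS (R : realType) (K : finType) (p : K -> R) n (x : K -> nat) :
  multinomial_weight p n.+1 x =
  \sum_(k | (0 < x k)%N) p k * multinomial_weight p n (decr k x).
Proof.
rewrite /multinomial_weight; have [xn|xn] := eqVneq; last first.
  rewrite big1// => k xk; rewrite ifF ?mulr0//; apply/eqP => e.
  by move: xn; rewrite (sum_decr xk) e eqxx.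
pose c := \prod_k (p k ^+ x k / (x k)`!%:R) : R.
transitivity (\sum_(k | (0 < x k)%N) (x k)%:R * n`!%:R * c).
  rewrite -mulr_suml -mulr_suml -natr_sum factS natrM; congr (_%:R * _ * _).
  by rewrite -xn [RHS]big_mkcond/=; apply: eq_bigr => k _; case: (x k).
apply: eq_bigr => k xk; rewrite ifT; last first.
  by rewrite -eqSS -(sum_decr xk) xn.
rewrite /c (bigD1 k)//= [in RHS](bigD1 k)//= {1 2}/decr eqxx subn1.
under [X in _ = _ * (_ * (_ * X))]eq_bigr => l /negPf lk.
  rewrite /decr lk subn0; over.
case: (x k) xk => // m _; rewrite exprS factS natrM /=.
by field; rewrite pnatr_eq0 -lt0n fact_gt0 addrC natr1 pnatr_eq0.
Qed.

(** The factorials of [n] cancel, and [exp (- L)] and [L ^+ n] split over the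
    colours because the [p k] sum to [1] and the [x k] to [n]. *)
Lemma multinomial_poisson (R : realType) (K : finType) (p : K -> R) (L : R) (x : K -> nat) :
  0 <= L -> (forall k, 0 <= p k) -> \sum_k p k = 1 ->
  (poisson_prob L 0 [set (\sum_k x k)%N] * (multinomial_weight p (\sum_k x k) x)%:E
   = \prod_k poisson_prob (p k * L) 0 [set x k])%E.
Proof.
move=> L0 p0 p1; rewrite /multinomial_weight eqxx poisson_prob1// -EFinM.
under [RHS]eq_bigr => k _ do rewrite poisson_prob1 ?mulr_ge0//.
rewrite prodEFin; congr EFin.
have eL : expR (- L) = \prod_k expR (- (p k * L)).
  by rewrite -expR_sum sumrN -mulr_suml p1 mul1r.
transitivity (\prod_k (p k ^+ x k / (x k)`!%:R) * L ^+ (\sum_k x k)%N * expR (- L)).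
  by field; rewrite pnatr_eq0 -lt0n fact_gt0.
rewrite eL expr_sum -!big_split; apply: eq_bigr => k _ /=.
by rewrite exprMn; ring.
Qed.

(** * Events that depend on finitely many times *)

Lemma discrete_right_limit (R : realType) (N : R -> nat) (u : R) n :
  (N @ u^'+ --> n) <-> (\forall s \near u^'+, N s = n).
Proof.
split=> [/(_ [set n] (discrete_set1 n))//|Nu A An].
have /= nA := nbhs_singleton An.
by apply: filterS Nu => s /= ->.
Qed.

Section Cylinders.
Context d (T : measurableType d) (R : realType).
Implicit Types Z : R -> T -> nat.

(** [A] is a union of fibres of [Z]. *)
Lemma determined_discrete (G : set_system T) (V : Type) (Z : T -> V) (A : set T) :
  discrete_variable G Z -> (forall w w', Z w = Z w' -> A w -> A w') -> G A.
Proof.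
move=> dZ AZ; rewrite (_ : A = Z @^-1` (Z @` A)); first exact: dZ.
by apply/seteqP; split => [w Aw|w [w' Aw' /AZ]]; [exists w|exact].
Qed.

(** The events determined by the values of [Z] at finitely many times.  Listing
    the times but not the values makes it harmless to add further times. *)
Definition cylinder Z : set_system T := [set A | exists2 s : seq R,
  (forall t, t \in s -> 0 <= t) &
  forall w w', (forall t, t \in s -> Z t w = Z t w') -> A w -> A w'].

Lemma cylinderI Z : setI_closed (cylinder Z).
Proof.
move=> A B [s s0 As] [r r0 Br]; exists (s ++ r).
  by move=> t; rewrite mem_cat => /orP[/s0|/r0].
move=> w w' E [Aw Bw]; split.
  by apply: As Aw => t ts; apply: E; rewrite mem_cat ts.
by apply: Br Bw => t tr; apply: E; rewrite mem_cat tr orbT.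
Qed.

Lemma cylinder_sigma (G : set_system T) Z : sigma_algebra setT G ->
  (forall t, 0 <= t -> discrete_variable G (Z t)) -> cylinder Z `<=` G.
Proof.
move=> sG dZ A [s s0 As].
have ds : discrete_variable G (fun w => [ffun i : 'I_(size s) => Z s`_i w]).
  by apply: discrete_variable_ffun => // i; apply/dZ/s0/mem_nth.
apply: determined_discrete ds _ => w w' /ffunP e; apply: As => t ts.
have i : (index t s < size s)%N by rewrite index_mem.
by have := e (Ordinal i); rewrite !ffunE /= nth_index.
Qed.

Lemma sigma_process_cylinder Z : sigma_process Z `<=` <<s cylinder Z >>.
Proof.
apply: sub_sigma_algebra2 => _ [t t0 [B _ <-]]; exists [:: t].
  by move=> u; rewrite inE => /eqP ->.
by move=> w w' e; rewrite /= -(e t)// inE.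
Qed.

Lemma sigma_process_variable Z t B : 0 <= t -> sigma_process Z (Z t @^-1` B).
Proof.
move=> t0; apply: sub_sigma_algebra; exists t => //.
by exists B => //; rewrite setTI.
Qed.

End Cylinders.

(** The grid [g] sorts [s] after a leading [0] and is constant from the last time
    on. *)
Lemma nondecreasing_grid (R : realType) (s : seq R) :
  (forall t, t \in s -> 0 <= t) -> exists g : nat -> R,
  [/\ g 0%N = 0, forall i, g i <= g i.+1 &
      forall t, t \in s -> exists2 j, (j <= size s)%N & t = g j].
Proof.
move=> s0; pose s' := sort <=%R s.
exists (fun i => nth 0 (0 :: s') (minn i (size s))).
have ss : sorted <=%R (0 :: s').
  rewrite /= path_min_sorted ?sort_le_sorted//.
  by apply/allP => t; rewrite mem_sort; exact: s0.
split=> //=; first by rewrite min0n.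
- move=> i; apply: (sorted_leq_nth le_trans le_refl _ ss);
    rewrite ?inE /= ?size_sort ?ltnS ?geq_minr//.
  by rewrite leq_min geq_minr andbT (leq_trans (geq_minl _ _)).
- move=> t ts; have ts' : t \in s' by rewrite mem_sort.
  exists (index t s').+1; first by rewrite -(size_sort <=%R) index_mem.
  rewrite (minn_idPl _) /= ?nth_index//.
  by rewrite -(size_sort <=%R) index_mem.
Qed.

(** * Colouring the events of a Poisson process *)

Section Thinning.
Context d (T : measurableType d) (R : realType) (P : probability T R).
Context (K : finType) (F : nat -> set_system T) (C : nat -> T -> K) (p : K -> R).
(* [F n] is the information available before the [n]-th colour [C n] is drawn;
   it contains the whole process [N] from the start, see [NF] below. *)
Hypothesis sF : forall n, sigma_algebra setT (F n).
Hypothesis Fm : forall n, F n `<=` measurable.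
Hypothesis FS : forall n, F n `<=` F n.+1.
Hypothesis CF : forall n k, F n.+1 (C n @^-1` [set k]).
Hypothesis PC : forall n k A, F n A ->
  P (A `&` C n @^-1` [set k]) = ((p k)%:E * P A)%E.

Definition colour_count k n w := (\sum_(i < n) (C i w == k))%N.

Lemma le_filtration m n : (m <= n)%N -> F m `<=` F n.
Proof.
move=> /subnK <-; elim: (n - m)%N => // {}n IH A /IH; exact: FS.
Qed.

Lemma colour_countS k n w :
  colour_count k n.+1 w = (colour_count k n w + (C n w == k))%N.
Proof. by rewrite /colour_count big_ord_recr. Qed.

Lemma colour_count_le k w m n : (m <= n)%N ->
  (colour_count k m w <= colour_count k n w)%N.
Proof.
move=> /subnK <-; elim: (n - m)%N => // {}n IH.
by rewrite addSn colour_countS (leq_trans IH)// leq_addr.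
Qed.

Lemma sum_colour_count n w : (\sum_k colour_count k n w = n)%N.
Proof.
rewrite exchange_big/= -[RHS](card_ord n) -sum1_card; apply: eq_bigr => i _.
by rewrite (bigD1 (C i w))//= eqxx big1// => k /negPf; rewrite eq_sym => ->.
Qed.

Lemma colour_weight_ge0 k : 0 <= p k.
Proof.
have [F0 FC _] := sF 0; have FT : F 0 setT by rewrite -(setD0 setT); exact: FC.
rewrite -lee_fin; have := PC k FT; rewrite probability_setT mule1 => <-.
exact: measure_ge0.
Qed.

Lemma colour_weight_sum : \sum_k p k = 1.
Proof.
have [F0 FC _] := sF 0; have FT : F 0 setT by rewrite -(setD0 setT); exact: FC.
apply: EFin_inj; rewrite -sumEFin -(probability_setT P).
rewrite (measure_fin_partition _ (Z := C 0%N))//; last first.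
  by move=> k; exact/Fm/CF.
by apply: eq_bigr => k _; rewrite PC// probability_setT mule1.
Qed.

Lemma colour_discrete m n : (m < n)%N -> discrete_variable (F n) (C m).
Proof.
move=> mn; apply: (discrete_variable_countable (sF n)) => k.
exact: le_filtration (CF m k).
Qed.

Lemma colour_count_discrete k m n : (m <= n)%N ->
  discrete_variable (F n) (colour_count k m).
Proof.
elim: m => [_|m IH mn].
  rewrite (_ : colour_count k 0 = fun=> 0%N); first exact: discrete_variable_cst.
  by apply/funext => w; rewrite /colour_count big_ord0.
rewrite (_ : colour_count k m.+1 =
    (fun x => x.1 + (x.2 == k))%N \o (fun w => (colour_count k m w, C m w))).
  apply: discrete_variable_comp; apply: discrete_variable_pair => //.
    by apply: IH; exact: ltnW.
  exact: colour_discrete.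
by apply/funext => w; rewrite colour_countS.
Qed.

Definition block_event m n (x : K -> nat) := [set w |
  forall k, colour_count k (m + n) w = (colour_count k m w + x k)%N].

Lemma block_eventF m n x : F (m + n) (block_event m n x).
Proof.
have dS : discrete_variable (F (m + n))
    (fun w => ([ffun k => colour_count k (m + n) w], [ffun k => colour_count k m w])).
  by apply: discrete_variable_pair => //; apply: discrete_variable_ffun => // k;
    apply: colour_count_discrete; rewrite ?leq_addr.
rewrite (_ : block_event _ _ _ = (fun w =>
  ([ffun k => colour_count k (m + n) w], [ffun k => colour_count k m w])) @^-1`
  [set f : {ffun K -> nat} * {ffun K -> nat} | forall k, f.1 k = (f.2 k + x k)%N]).
  exact: dS.
by apply/seteqP; split => w /= H k; have := H k; rewrite !ffunE.
Qed.

(** Given the first [m] colours, those of the next [n] events are independent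
    draws.  Induction on [n], splitting along the colour of the last event. *)
Lemma block_law m n x B : F m B ->
  P (B `&` block_event m n x) = (P B * (multinomial_weight p n x)%:E)%E.
Proof.
move=> FB; elim: n x => [|n IH] x.
  rewrite multinomial_weight0; case: forallP => [x0|x0].
    rewrite mule1; congr (P _); apply/seteqP; split => [w []//|w Bw].
    by split => // k; rewrite addn0 (eqP (x0 k)) addn0.
  rewrite mule0 (_ : _ `&` _ = set0) ?measure0//.
  apply/seteqP; split => // w [_ H]; apply: x0 => k.
  by have := H k; rewrite addn0 -[LHS]addn0 => /addnI <-.
rewrite (measure_fin_partition _ (Z := C (m + n)%N)); last 2 first.
- apply: measurableI; first exact: Fm FB.
  by apply: Fm; exact: block_eventF.
- by move=> k; exact: Fm (CF _ k).
rewrite multinomial_weightS.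
have PBf : P B \is a fin_num by rewrite fin_num_measure//; exact: Fm FB.
transitivity (\sum_(k | (0 < x k)%N)
    (P B * (p k * multinomial_weight p n (decr k x))%:E))%E; last first.
  rewrite -(fineK PBf) -EFinM mulr_sumr -sumEFin.
  by apply: eq_bigr => k _; rewrite -EFinM.
rewrite [RHS]big_mkcond/=; apply: eq_bigr => k _; case: ifPn => xk; last first.
  rewrite (_ : _ `&` _ = set0) ?measure0//.
  apply/seteqP; split => // w [[_ H] /= Ck].
  have := H k; rewrite addnS colour_countS Ck eqxx.
  move: xk; rewrite -eqn0Ngt => /eqP ->.
  by have := colour_count_le k w (leq_addr n m); lia.
rewrite (_ : B `&` _ `&` _ = (B `&` block_event m n (decr k x)) `&` C (m + n)%N @^-1` [set k]).
  rewrite PC; last first.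
    apply: sigma_algebra_cap => //; last exact: block_eventF.
    by apply: le_filtration FB; rewrite leq_addr.
  by rewrite IH EFinM muleCA.
apply/seteqP; split => w [[Bw H] /= Ck]; split => //; split => // l;
  have := H l; rewrite addnS colour_countS Ck /decr.
  have [kl|_] /= := eqVneq k l; last by lia.
  by move: xk; rewrite kl; lia.
have [kl|_] /= := eqVneq k l; last by lia.
by move: xk; rewrite kl; lia.
Qed.

Definition blocks_event (n : nat -> nat) (y : nat -> K -> nat) r := [set w |
  forall i, (i < r)%N ->
  forall k, colour_count k (\sum_(j < i.+1) n j) w =
    (colour_count k (\sum_(j < i) n j) w + y i k)%N].

Lemma blocks_law (n : nat -> nat) (y : nat -> K -> nat) r A : F 0 A ->
  F (\sum_(j < r) n j) (A `&` blocks_event n y r) /\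
  P (A `&` blocks_event n y r) =
    (P A * (\prod_(i < r) multinomial_weight p (n i) (y i))%:E)%E.
Proof.
move=> FA; elim: r => [|r [IHF IHP]].
  rewrite !big_ord0 mule1 (_ : blocks_event n y 0 = setT) ?setIT//.
  by apply/seteqP; split.
have -> : A `&` blocks_event n y r.+1 = (A `&` blocks_event n y r) `&`
    block_event (\sum_(j < r) n j) (n r) (y r).
  apply/seteqP; split => w.
    move=> [Aw H]; split; first by split=> // i ir; apply: H; exact: ltnW.
    by move=> k; have := H r (ltnSn r) k; rewrite big_ord_recr.
  move=> [[Aw H] Hr]; split=> // i; rewrite ltnS leq_eqVlt => /predU1P[->|]; last exact: H.
  by move=> k; rewrite big_ord_recr/=; exact: Hr.
rewrite !big_ord_recr/= block_law// IHP; split; last by rewrite EFinM muleA.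
apply: sigma_algebra_cap => //; last exact: block_eventF.
by apply: le_filtration IHF; rewrite leq_addr.
Qed.

(* [E0] is the information at time [0] of which the colour counts have to be
   independent. *)
Context (lam : R -> R) (N : R -> T -> nat) (E0 : set_system T).
Hypothesis HN : poisson_process P lam N.
Hypothesis lam_ge0 : forall s t, 0 <= s -> s <= t -> 0 <= cumulative_rate lam s t.
Hypothesis NF : forall t, 0 <= t -> discrete_variable (F 0) (N t).
Hypothesis E0F : E0 `<=` F 0.
Hypothesis E0N : forall E A, E0 E -> sigma_process N A ->
  P (E `&` A) = (P E * P A)%E.

Definition coloured k t w := colour_count k (N t w) w.

Lemma sum_coloured t w : (\sum_k coloured k t w = N t w)%N.
Proof. exact: sum_colour_count. Qed.

Lemma coloured0 k w : coloured k 0 w = 0%N.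
Proof. by rewrite /coloured (poisson_start HN) /colour_count big_ord0. Qed.

Lemma coloured_le k w s t : 0 <= s -> s <= t -> (coloured k s w <= coloured k t w)%N.
Proof. by move=> s0 st; apply: colour_count_le; exact: (poisson_nondecreasing HN). Qed.

Lemma coloured_measurable k t : 0 <= t -> measurable_fun setT (coloured k t).
Proof.
move=> t0 _ B _; rewrite setTI.
apply: (discrete_variable_index (sigma_algebra_measurable T) (M := N t)
   (Z := fun n w => colour_count k n w)).
  by move=> A; apply: Fm; exact: NF.
by move=> n A; apply/Fm; exact: (@colour_count_discrete k n n).
Qed.

Definition counts_event (t : nat -> R) (n : nat -> nat) r := [set w |
  forall i, (i < r)%N -> N (t i.+1) w = (N (t i) w + n i)%N].

Hypothesis E0T : E0 setT.
Hypothesis E0I : setI_closed E0.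

Section Grid.
Context (t : nat -> R).
Hypothesis t0 : 0 <= t 0.
Hypothesis tS : forall i, t i <= t i.+1.

Lemma grid_ge0 i : 0 <= t i.
Proof. by elim: i => // i /le_trans; exact. Qed.
Local Hint Resolve grid_ge0 : core.

Lemma counts_eventE (n : nat -> nat) r : counts_event t n r =
  \bigcap_(i in [set` [set: 'I_r]%SET])
    [set w | (N (t i.+1) w - N (t i) w)%N = n i].
Proof.
apply/seteqP; split => w /=.
  by move=> H i _ /=; rewrite H// addKn.
move=> H i ir; have := H (Ordinal ir); rewrite /= inE => /(_ isT) <-.
by rewrite subnKC// (poisson_nondecreasing HN).
Qed.

Lemma counts_event_sigma (G : set_system T) (n : nat -> nat) r :
  sigma_algebra setT G -> (forall s, 0 <= s -> discrete_variable G (N s)) ->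
  G (counts_event t n r).
Proof.
move=> sG GN; have dN : discrete_variable G (fun w => [ffun i : 'I_r.+1 => N (t i) w]).
  by apply: discrete_variable_ffun => // i B; exact: GN.
rewrite (_ : counts_event t n r = (fun w => [ffun i : 'I_r.+1 => N (t i) w]) @^-1`
  [set f : {ffun 'I_r.+1 -> nat} |
    forall i : 'I_r, f (lift ord0 i) = (f (widen_ord (leqnSn r) i) + n i)%N]).
  exact: dN.
apply/seteqP; split => w /= H i; first by rewrite !ffunE /=; exact: H.
by move=> ir; have := H (Ordinal ir); rewrite !ffunE.
Qed.

(** The independence of [E0] from [N] and the independent increments of [N]. *)
Lemma counts_law E (n : nat -> nat) r : E0 E ->
  P (E `&` counts_event t n r) = (P E *
    \prod_(i < r) poisson_prob (cumulative_rate lam (t i) (t i.+1)) 0 [set n i])%E.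
Proof.
move=> EE; rewrite E0N//; last first.
  apply: counts_event_sigma; first exact: smallest_sigma_algebra.
  by move=> s s0 B; exact: sigma_process_variable.
have ind := poisson_indep_increments HN (n := r) t0 tS.
congr (_ * _)%E; rewrite counts_eventE ind; last first.
  by move=> i _; exists [set n i] => //; rewrite setTI.
apply: eq_big => [i|i _]; first by rewrite inE.
by rewrite -(poisson_law_increments HN).
Qed.

Definition increment k i w := (coloured k (t i.+1) w - coloured k (t i) w)%N.

Lemma increment_measurable k i : measurable_fun setT (increment k i).
Proof.
move=> _ B _; rewrite setTI.
apply: (discrete_variable_comp (fun x => x.1 - x.2)%N
  (Z := fun w => (coloured k (t i.+1) w, coloured k (t i) w))).
by apply: discrete_variable_pair => [|C'|C']; [exact: sigma_algebra_measurable|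
  rewrite -[_ @^-1` _]setTI; exact: coloured_measurable..].
Qed.

Hypothesis t00 : t 0%N = 0.

(** The grid starts at [0], where [N] vanishes, so the increments of [N] determine
    which of the colours fall into which interval; these blocks of colours are
    governed by [blocks_law]. *)
Lemma increments_joint_law E (y : nat -> K -> nat) r : E0 E ->
  P (E `&` [set w | forall i, (i < r)%N -> forall k, increment k i w = y i k]) =
  (P E * \prod_(i < r) \prod_k
     poisson_prob (p k * cumulative_rate lam (t i) (t i.+1)) 0 [set y i k])%E.
Proof.
move=> EE; pose n i := (\sum_k y i k)%N.
(* On these increments of the colours, N increases by n i on the i-th interval,
   and so its value at t i is the sum of the previous n j. *)
have -> : E `&` [set w | forall i, (i < r)%N -> forall k, increment k i w = y i k] =
    (E `&` counts_event t n r) `&` blocks_event n y r.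
  have incE w i k : (increment k i w = y i k) <->
      (coloured k (t i.+1) w = (coloured k (t i) w + y i k)%N).
    have := coloured_le k w (grid_ge0 i) (tS i).
    by rewrite /increment; split; lia.
  have NE w : counts_event t n r w -> forall i, (i <= r)%N -> N (t i) w = (\sum_(j < i) n j)%N.
    move=> H; elim => [_|i IH ir]; first by rewrite t00 (poisson_start HN) big_ord0.
    by rewrite big_ord_recr/= H// IH// ltnW.
  apply/seteqP; split => w.
    move=> [Ew H].
    have cw : counts_event t n r w.
      move=> i ir; rewrite -!sum_coloured -big_split; apply: eq_bigr => k _.
      exact/incE/H.
    split=> // i ir k; rewrite -(NE w cw i.+1 ir) -(NE w cw i (ltnW ir)).
    exact/incE/H.
  move=> [[Ew cw] H]; split => // i ir k; apply/incE.
  by rewrite /coloured (NE w cw i.+1 ir) (NE w cw i (ltnW ir)); exact: H.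
have FEN : F 0 (E `&` counts_event t n r).
  by apply: sigma_algebra_cap => //; [exact: E0F|exact: counts_event_sigma].
have [_ ->] := blocks_law n y r FEN.
rewrite counts_law// -muleA; congr (_ * _)%E.
rewrite -prodEFin -big_split/=; apply: eq_bigr => i _.
apply: multinomial_poisson; [exact: lam_ge0|exact: colour_weight_ge0|exact: colour_weight_sum].
Qed.

(** The index [None] carries the events [E0] of the initial time. *)
Lemma increments_independent r :
  (forall k (i : 'I_r) B, P (increment k i @^-1` B) =
     poisson_prob (p k * cumulative_rate lam (t i) (t i.+1)) 0 B) /\
  mutually_independent P (fun o : option ('I_r * K) =>
    if o is Some j then sigma_var (increment j.2 j.1) else E0).
Proof.
pose m (j : 'I_r * K) : probability nat R :=
  poisson_prob (p j.2 * cumulative_rate lam (t j.1) (t j.1.+1)) 0.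
have [||j|E EE x|law ind] := @mutually_independent_joint_law _ _ _ P
  _ E0 (fun j : 'I_r * K => increment j.2 j.1) m.
- exact: E0T.
- by move=> A /E0F/Fm.
- exact: increment_measurable.
- pose y i k := if insub i is Some i' then x (i', k) else 0%N.
  have yx (i : 'I_r) k : y i k = x (i, k) by rewrite /y valK.
  have -> : (\prod_j m j [set x j] = \prod_(i < r) \prod_k poisson_prob (p k *
      cumulative_rate lam (t i) (t i.+1)) 0 [set y i k])%E.
    by rewrite pair_bigA; apply: eq_bigr => -[i k] _; rewrite yx.
  rewrite -increments_joint_law//; congr (P (_ `&` _)).
  apply/seteqP; split => w /=.
    move=> H i ir k; have := H (Ordinal ir, k) Logic.I; rewrite -yx; exact.
  by move=> H [i k] _ /=; rewrite H// yx.
- by split => // k i B; exact: (law (i, k)).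
Qed.

End Grid.

(** All the times that occur are put on one grid.  The value of a colour count at
    a grid time is a sum of increments, so a cylinder event of colour [k] belongs
    to the sigma-algebra of the increments of that colour. *)
Lemma coloured_independent_cylinders : mutually_independent P (fun o : option K =>
  if o is Some k then cylinder (coloured k) else E0).
Proof.
move=> J A FA.
have /choice[s sP] : forall k, exists s : seq R, (forall t, t \in s -> 0 <= t) /\
    (Some k \in J -> forall w w', (forall t, t \in s -> coloured k t w = coloured k t w') ->
      A (Some k) w -> A (Some k) w').
  move=> k; have [/FA[s s0 As]|kJ] := boolP (Some k \in J); first by exists s.
  by exists [::].
pose S := flatten [seq s k | k <- enum K].
have sS k u : u \in s k -> u \in S.
  by move=> us; apply/flatten_mapP; exists k; rewrite ?mem_enum.
have [|g [g0 gS gP]] := @nondecreasing_grid R S.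
  by move=> u /flatten_mapP[k _]; have [+ _] := sP k; exact.
have g00 : 0 <= g 0%N by rewrite g0.
have [_ ind] := increments_independent g00 gS g0 (size S).
pose h : option ('I_(size S) * K) -> option K := omap snd.
have vm (o : option ('I_(size S) * K)) :
    (if o is Some j then sigma_var (increment g j.2 j.1) else E0) `<=` measurable.
  case: o => [[i k]|]; last by move=> B /E0F/Fm.
  by move=> _ [B mB <-]; exact: (increment_measurable g00 gS k i measurableT mB).
have vI (o : option ('I_(size S) * K)) :
    setI_closed (if o is Some j then sigma_var (increment g j.2 j.1) else E0).
  case: o => [[i k]|]; last exact: E0I.
  by move=> _ _ [B _ <-] [B' _ <-]; exists (B `&` B') => //; rewrite !setTI preimage_setI.
have indh := mutually_independent_grouped (h := h) vm vI ind.
apply: (indh J A) => -[k|] oJ; last first.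
  apply: sub_sigma_algebra; exists (fun=> A None).
    by case=> [//|_]; exact: (FA None).
  by apply/seteqP; split => [w Aw i _ //|w]; apply; exact: (erefl : h None = None).
set G := smallest _ _.
have sG : sigma_algebra setT G by exact: smallest_sigma_algebra.
have dG : discrete_variable G (fun w => [ffun i : 'I_(size S) => increment g k i w]).
  apply: discrete_variable_ffun => // i B; apply: sub_sigma_algebra.
  exists (fun o => if o == Some (i, k) then increment g k i @^-1` B else setT).
    move=> [[i' k']|] // [] ->; case: eqP => [[->]|_].
      by exists B => //; rewrite setTI.
    by exists setT => //; rewrite setTI preimage_setT.
  apply/seteqP; split => w /=.
    by move=> Bw o _; case: eqP.
  by move=> /(_ (Some (i, k)) erefl) /=; rewrite eqxx.
apply: determined_discrete dG _ => w w' /ffunP ee.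
have [_ As] := sP k; apply: As => // u /sS /gP[j jS ->] {u}.
elim: j jS => [|j IH] jS; first by rewrite g0 !coloured0.
have := ee (Ordinal jS); rewrite !ffunE /increment /=.
have := IH (ltnW jS).
have := coloured_le k w (grid_ge0 g00 gS j) (gS j).
have := coloured_le k w' (grid_ge0 g00 gS j) (gS j).
by lia.
Qed.

(** The cylinder events form pi-systems that generate the sigma-algebras of the
    processes. *)
Theorem thinning_independent : mutually_independent P (fun o : option K =>
  if o is Some k then sigma_process (coloured k) else E0).
Proof.
apply: mutually_independent_sub
  (mutually_independent_generated _ _ coloured_independent_cylinders).
- by case=> [k|]; [exact: sigma_process_cylinder|exact: sub_sigma_algebra].
- case=> [k|]; last by move=> B /E0F/Fm.
  apply: cylinder_sigma; first exact: sigma_algebra_measurable.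
  by move=> u u0 B; rewrite -[_ @^-1` _]setTI; exact: coloured_measurable.
- by case=> [k|]; [exact: cylinderI|exact: E0I].
Qed.

(** The increments of one colour on a grid, to which [0] is prepended because the
    joint law is known only on grids starting there. *)
Theorem thinning_poisson k (mu : R -> R) :
  (forall s t, 0 <= s -> s <= t ->
    cumulative_rate mu s t = p k * cumulative_rate lam s t) ->
  poisson_process P mu (coloured k).
Proof.
move=> muE; split.
- by move=> u; exact: coloured_measurable.
- exact: coloured0.
- by move=> w u v; exact: coloured_le.
- move=> w u u0; have := poisson_right_continuous HN (w := w) u0.
  move=> /discrete_right_limit Nu; apply/discrete_right_limit.
  by apply: filterS Nu => v; rewrite /coloured => ->.
- move=> n t t0 tS.
  pose g i := if i is j.+1 then t j else 0.
  have gS i : g i <= g i.+1 by case: i.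
  have [_] := increments_independent (lexx _ : 0 <= g 0%N) gS erefl n.+1.
  apply: (mutually_independent_inj (h := fun i : 'I_n => Some (lift ord0 i, k))).
    by move=> i j [e]; apply: val_inj; move: e; rewrite /= /bump; lia.
  by move=> i A [B _ <-]; exists B.
- move=> u v B u0 uv; pose g i := if i is j.+1 then (if j is 0 then u else v) else 0.
  have gS i : g i <= g i.+1 by case: i => [|[|i]].
  have [law _] := increments_independent (lexx _ : 0 <= g 0%N) gS erefl 2.
  by have := law k ord_max B; rewrite muE.
Qed.

End Thinning.

(** * The cumulative rate *)

Section Rates.
Context (R : realType) (lam : R -> R).
Hypothesis lam_C1 : C1_nonneg_rate lam.
Hypothesis lam_int : forall t, 0 < t ->
      (\int[lebesgue_measure]_(s in `]0%R, t]) (lam s)%:E < +oo)%E.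
Local Notation leb := (@lebesgue_measure R).

Lemma rate_continuous t : 0 < t -> {for t, continuous lam}.
Proof.
case: lam_C1 => _ dlam _ t0.
by apply: differentiable_continuous; apply/derivable1_diffP; exact: dlam.
Qed.

Lemma rate_measurable : measurable_fun (`]0, +oo[%classic : set R) lam.
Proof.
apply: open_continuous_measurable_fun; first exact: interval_open.
by move=> t; rewrite inE /= in_itv/= andbT; exact: rate_continuous.
Qed.

(** The rate is controlled on positive times only, but [0] is a null set. *)
Lemma rate_integrable t : 0 < t -> leb.-integrable `[0, t] (EFin \o lam).
Proof.
move=> t0; have ml : measurable_fun (`]0, t]%classic : set R) lam.
  apply: measurable_funS rate_measurable => //.
  by move=> s /=; rewrite !in_itv/= => /andP[-> _].
have ml' : measurable_fun (`[0, t]%classic : set R) lam.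
  exact/measurable_fun_itv_obnd_cbndP.
apply/integrableP; split; first exact/measurable_EFinP.
rewrite -integral_itv_obnd_cbnd; last first.
  by apply: measurableT_comp => //; exact/measurable_EFinP.
have [lam0 _ _] := lam_C1.
under eq_integral => s.
  rewrite inE /= in_itv/= => /andP[s0 _].
  rewrite ger0_norm ?lam0//; over.
exact: lam_int.
Qed.

Lemma rate_integrable_oc s t : 0 <= s -> leb.-integrable `]s, t] (EFin \o lam).
Proof.
move=> s0; have [ts|st] := leP t s.
  by rewrite set_itv_ge ?bnd_simp -?leNgt//; exact: integrable_set0.
apply: integrableS (rate_integrable (le_lt_trans s0 st)) => //.
by apply: subset_itv; rewrite bnd_simp.
Qed.

Lemma cumulative_rate_ge0 s t : 0 <= s -> s <= t -> 0 <= cumulative_rate lam s t.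
Proof.
move=> s0 _; have [lam0 _ _] := lam_C1; apply: Rintegral_ge0 => u /=.
by rewrite in_itv/= => /andP[su _]; apply: lam0; exact: le_lt_trans su.
Qed.

Lemma cumulative_rateZ a s t : 0 <= s ->
  cumulative_rate (fun u => a * lam u) s t = a * cumulative_rate lam s t.
Proof. by move=> s0; rewrite /cumulative_rate RintegralZl//; exact: rate_integrable_oc. Qed.

Lemma cumulative_rate_continuous t : 0 < t ->
  {within `[0, t], continuous (cumulative_rate lam 0)}.
Proof.
move=> t0; rewrite (_ : cumulative_rate lam 0 =
  fun u => parameterized_integral leb 0 u lam).
  by apply: parameterized_integral_continuous; [exact: ltW|exact: rate_integrable].
apply/funext => u; rewrite /cumulative_rate /parameterized_integral.
by rewrite Rintegral_itv_obnd_cbnd//; exact: rate_integrable_oc.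
Qed.

Lemma cumulative_rate0 : cumulative_rate lam 0 0 = 0.
Proof. by rewrite /cumulative_rate set_itv_ge ?bnd_simp// Rintegral_set0. Qed.

(** By continuity [lam] exceeds half of [lam t] on an interval ending at [t]. *)
Lemma cumulative_rate_gt0 t : 0 < t -> lam t != 0 -> 0 < cumulative_rate lam 0 t.
Proof.
have [lam0 _ _] := lam_C1 => t0 lt0.
have lt_gt0 : 0 < lam t by rewrite lt_neqAle eq_sym lt0 lam0.
have [e /= e0 He] : \forall s \near t, lam t / 2 < lam s.
  have lt2 : lam t / 2 < lam t by rewrite ltr_pdivrMr// ltr_pMr// ltr1n.
  exact: (cvgr_gt (lam t) (rate_continuous t0)).
pose a := Num.max (t - e / 2) (t / 2).
have at_ : a < t by rewrite gt_max; apply/andP; split; lra.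
have a0 : 0 < a by rewrite lt_max; apply/orP; right; lra.
have I0a : 0 <= cumulative_rate lam 0 a by apply: cumulative_rate_ge0 => //; exact: ltW.
rewrite (lt_le_trans (_ : 0 < lam t / 2 * (t - a)))//.
  by rewrite mulr_gt0// ?divr_gt0// subr_gt0.
have /= := @Rintegral_itvB _ lam (BRight 0) (BRight t) a (rate_integrable_oc t (lexx _)).
rewrite !bnd_simp => /(_ (ltW a0) (ltW at_)) ita.
suff : lam t / 2 * (t - a) <= \int[leb]_(u in `]a, t]) lam u.
  rewrite -ita; move: I0a; rewrite /cumulative_rate; lra.
have -> : lam t / 2 * (t - a) = \int[leb]_(_ in `]a, t]) (lam t / 2).
  rewrite Rintegral_cst//; congr (_ * _).
  by rewrite [X in fine X]lebesgue_measure_itv /= lte_fin at_.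
apply: le_Rintegral => //.
- apply: measurable_bounded_integrable => //; last exact: bounded_cst.
  by rewrite [X in (X < _)%E]lebesgue_measure_itv /= lte_fin at_ ltry.
- by apply: rate_integrable_oc; exact: ltW.
move=> u /=; rewrite in_itv/= => /andP[au ut]; apply/ltW/He => /=.
rewrite ger0_norm ?subr_ge0//.
have : t - e / 2 <= a by rewrite le_max lexx.
lra.
Qed.

Lemma cumulative_rate_IVT t v : 0 < t -> 0 <= v <= cumulative_rate lam 0 t ->
  exists2 s, 0 <= s <= t & cumulative_rate lam 0 s = v.
Proof.
move=> t0 /andP[v0 vt]; have := IVT (ltW t0) (cumulative_rate_continuous t0) (v := v).
rewrite cumulative_rate0 => -[|s]; last by rewrite in_itv/=; exists s.
rewrite (min_idPl _) ?(max_idPr _) ?v0//;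
  by rewrite cumulative_rate_ge0// ltW.
Qed.

End Rates.

(** * Integrals along counting paths *)

Section CountingPaths.
Context (R : realType) (n : R -> nat).
Hypothesis n_le : forall s t, 0 <= s -> s <= t -> (n s <= n t)%N.
Local Notation leb := (@lebesgue_measure R).

(** A level set of a nondecreasing path is an interval. *)
Lemma counting_path_measurable (t : R) :
  measurable_fun (`[0, t]%classic : set R) n.
Proof.
move=> _ B _.
have -> : `[0, t]%classic `&` n @^-1` B =
    \bigcup_(k in B) (`[0, t]%classic `&` n @^-1` [set k]).
  apply/seteqP; split => [s [st Bs]|s [k Bk [st ns]]]; first by exists (n s).
  by split => //=; rewrite ns.
apply: (sigma_algebra_countable_cup (sigma_algebra_measurable _)) => k _.
apply: is_interval_measurable => x y /=; rewrite !in_itv/=.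
move=> [/andP[x0 xt] nx] [/andP[y0 yt] ny] z /andP[xz zy].
have z0 := le_trans x0 xz.
rewrite in_itv /= z0 (le_trans zy)//; split=> //.
by apply/eqP; rewrite eqn_leq -{1}ny -nx !n_le.
Qed.

Lemma counting_path_integrable (g : nat -> R) (t : R) :
  leb.-integrable `[0, t] (EFin \o (fun s => g (n s))).
Proof.
have [t0|t0] := ltP t 0.
  by rewrite set_itv_ge ?bnd_simp -?ltNge//; exact: integrable_set0.
apply: measurable_bounded_integrable => //.
- rewrite [X in (X < _)%E]lebesgue_measure_itv /=; case: ifP => _; exact: ltry.
- apply: (measurableT_comp (f := g)); last exact: counting_path_measurable.
  by [].
- exists (\sum_(k < (n t).+1) `|g k|); split; first by rewrite num_real.
  move=> M ltM s /=; rewrite in_itv/= => /andP[s0 st].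
  rewrite (le_trans _ (ltW ltM))//.
  have nst : (n s < (n t).+1)%N by rewrite ltnS n_le.
  by rewrite (bigD1 (Ordinal nst))//= lerDl sumr_ge0.
Qed.

Context (v : R) (b : nat -> bool).
Hypothesis v_gt0 : 0 < v.
Hypothesis n_rcont : forall t, 0 <= t -> \forall s \near t^'+, n s = n t.

(** If the velocity is [- v] at some [s < t], it is so on a whole interval by right
    continuity, and the integral loses a positive amount.  The endpoint [t] is
    excluded since it does not contribute. *)
Lemma path_integral_top (t : R) : 0 < t ->
  (\int[leb]_(s in `[0, t]) (v * (-1) ^+ b (n s)) = v * t) <->
  (forall s, 0 <= s < t -> b (n s) = false).
Proof.
move=> t0; set f := fun s => v * (-1) ^+ b (n s).
have intf : leb.-integrable `[0, t] (EFin \o f).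
  exact: (counting_path_integrable (fun k => v * (-1) ^+ b k)).
have intc : leb.-integrable `[0, t] (EFin \o cst v).
  exact: (counting_path_integrable (fun=> v)).
have cstE : \int[leb]_(s in `[0, t]) v = v * t.
  rewrite Rintegral_cst//; congr (_ * _).
  by rewrite [X in fine X]lebesgue_measure_itv /= lte_fin t0 oppr0 addr0.
split=> [ft s /andP[s0 st]|fE]; last first.
  rewrite -cstE -!Rintegral_itv_bndo_bndc//; last 2 first.
  - by apply: integrableS intc => //; apply: subset_itv; rewrite bnd_simp.
  - by apply: integrableS intf => //; apply: subset_itv; rewrite bnd_simp.
  apply: eq_Rintegral => s; rewrite inE /= in_itv/= => sT.
  by rewrite fE// expr0 mulr1.
apply/negP => bs.
have [e /= e0 He] := n_rcont s0.
pose u := Num.min (s + e / 2) t.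
have su : s < u by rewrite lt_min st andbT ltrDl divr_gt0.
have ut : u <= t by rewrite ge_min lexx orbT.
have ue : u <= s + e / 2 by rewrite ge_min lexx.
have fs x : s < x <= u -> f x = - v.
  move=> /andP[sx xu]; rewrite /f (_ : n x = n s) ?bs ?expr1 ?mulrN1//.
  apply: (He x) => //=; rewrite ltr0_norm ?subr_lt0//; lra.
have sub : `]s, u]%classic `<=` (`[0, t]%classic : set R).
  by apply: subset_itv; rewrite bnd_simp// ltW.
have : 2 * v * (u - s) <= \int[leb]_(x in `[0, t]) (v - f x).
  have -> : 2 * v * (u - s) = \int[leb]_(x in `]s, u]) (v - f x).
    rewrite (@eq_Rintegral _ _ _ _ _ (fun=> 2 * v)); last first.
      move=> x; rewrite inE /= in_itv/= => xs; rewrite fs//; ring.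
    rewrite Rintegral_cst//; congr (_ * _).
    by rewrite [X in fine X]lebesgue_measure_itv /= lte_fin su.
  have intd : leb.-integrable `[0, t] (EFin \o (fun x => v - f x)).
    exact: (counting_path_integrable (fun k => v - v * (-1) ^+ b k)).
  rewrite /Rintegral fine_le//.
  + by apply: integrable_fin_num => //; exact: integrableS intd.
  + exact: integrable_fin_num.
  + apply: ge0_subset_integral => //; first exact: (measurable_int leb).
    move=> x _; rewrite lee_fin /f subr_ge0; case: (b _);
      rewrite /= ?expr1 ?expr0 ?mulrN1 ?mulr1 //.
    by apply: (le_trans _ (ltW v_gt0)); rewrite oppr_le0 ltW.
rewrite RintegralB// cstE ft subrr; apply/negP; rewrite -ltNge.
by rewrite !mulr_gt0// subr_gt0.
Qed.

End CountingPaths.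

(** * Directions as pairs of signs *)

(** [negU k] and [negV k] tell whether [U] and [V] move backwards in direction [k]. *)
Definition negU (k : 'I_4) : bool := (1 < k)%N.
Definition negV (k : 'I_4) : bool := (k == 1%N :> nat) || (k == 2%N :> nat).

Lemma directionU (R : realType) k :
  (direction R k).1 + (direction R k).2 = (-1) ^+ negU k.
Proof.
rewrite /direction /negU /=; case: k => [[|[|[|[|//]]]] /= _].
- by rewrite !mul0r cos0 sin0 addr0 expr0.
- by rewrite !mul1r cos_pihalf sin_pihalf add0r expr0.
- by rewrite mulrAC divff// mul1r cospi sinpi addr0 expr1.
- have -> : 3 * pi / 2 = pi + pi / 2 :> R by field.
  by rewrite addrC -[pi + _]addrC sinDpi cosDpi cos_pihalf sin_pihalf oppr0 addr0 expr1.
Qed.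

Lemma directionV (R : realType) k :
  (direction R k).1 - (direction R k).2 = (-1) ^+ negV k.
Proof.
rewrite /direction /negV /=; case: k => [[|[|[|[|//]]]] /= _].
- by rewrite !mul0r cos0 sin0 subr0 expr0.
- by rewrite !mul1r cos_pihalf sin_pihalf sub0r expr1.
- by rewrite mulrAC divff// mul1r cospi sinpi subr0 expr1.
- have -> : 3 * pi / 2 = pi + pi / 2 :> R by field.
  by rewrite -[pi + _]addrC sinDpi cosDpi cos_pihalf sin_pihalf oppr0 sub0r opprK expr0.
Qed.

Definition code k := (negU k, negV k).
Lemma code_inj : injective code.
Proof.
by case=> [[|[|[|[|//]]]] i]; case=> [[|[|[|[|//]]]] j] // _; apply: val_inj.
Qed.

(** The direction obtained from [k] by flipping the signs selected by [f]; the
    default value of [odflt] is never taken, by [code_turn]. *)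
Definition turn (k : 'I_4) (f : bool * bool) : 'I_4 :=
  odflt ord0 [pick j | code j == (negU k (+) f.1, negV k (+) f.2)].

Lemma code_turn k f : code (turn k f) = (negU k (+) f.1, negV k (+) f.2).
Proof.
rewrite /turn; case: pickP => [j /eqP //|].
move: (negU k (+) f.1) (negV k (+) f.2) => a b /= N.
have [j /eqP] : exists j, code j = (a, b); last by rewrite N.
by case: a b {N} => -[]; [exists (inord 2)|exists (inord 3)|exists (inord 1)|exists ord0];
  rewrite /code /negU /negV ?inordK.
Qed.

(** * The law of the sign flips *)

Section Motion.
Context d (T : measurableType d) (R : realType) (P : probability T R).
Context (c : R) (N : R -> T -> nat) (D : nat -> T -> 'I_4) (X Y : R -> T -> R).
Hypothesis XY : reflecting_motion P c N D X Y.
Hypothesis mN : forall t, 0 <= t -> measurable_fun setT (N t).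

(** All event times are included from the start: the directions are chosen
    independently of them. *)
Definition history n := <<s sigma_process N `|` sigma_family [set i | (i <= n)%N] D >>.

Lemma sigma_algebra_history n : sigma_algebra setT (history n).
Proof. exact: smallest_sigma_algebra. Qed.

Lemma history_measurable n : history n `<=` measurable.
Proof.
have mS : sigma_algebra setT (@measurable d T) := sigma_algebra_measurable T.
apply: smallest_sub => // A [|]; apply: smallest_sub => // {}A [i i0 [B mB <-]].
  exact: mN.
exact: (direction_measurable XY).
Qed.

Lemma historyS n : history n `<=` history n.+1.
Proof.
apply: sub_sigma_algebra2 => A [NA|DA]; [by left|right].
by apply: sub_sigma_algebra2 DA => {}A [i /= ni iA]; exists i => //=; exact: leqW.
Qed.

Lemma history_count t : 0 <= t -> discrete_variable (history 0) (N t).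
Proof.
by move=> t0 B; apply: sub_sigma_algebra; left; exact: sigma_process_variable.
Qed.

Lemma history_direction i n : (i <= n)%N -> discrete_variable (history n) (D i).
Proof.
move=> ni B; apply: sub_sigma_algebra; right; apply: sub_sigma_algebra.
by exists i => //; exists B => //; rewrite setTI.
Qed.

Definition flips n w : bool * bool :=
  (negU (D n w) (+) negU (D n.+1 w), negV (D n w) (+) negV (D n.+1 w)).

Lemma flipsE n w f : flips n w = f <-> D n.+1 w = turn (D n w) f.
Proof.
rewrite /flips; split => [<-|e].
  by apply: code_inj; rewrite code_turn /= !addbA !addbb.
by rewrite e; have := code_turn (D n w) f; case=> -> ->; rewrite !addbA !addbb; case: f {e}.
Qed.

Lemma turnE k f : (turn k f == k) = (f == (false, false)).
Proof.
rewrite -(inj_eq code_inj) code_turn /code !xpair_eqE.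
by case: f => [[] []]; case: (negU k) (negV k) => -[].
Qed.

Lemma flips_discrete n : discrete_variable (history n.+1) (flips n).
Proof.
apply: (discrete_variable_comp (fun x => (negU x.1 (+) negU x.2, negV x.1 (+) negV x.2))
  (Z := fun w => (D n w, D n.+1 w))).
by apply: discrete_variable_pair; [exact: sigma_algebra_history|exact: history_direction..].
Qed.

(** The three proper switches already carry the full probability. *)
Lemma direction_switch_self n k A : history n A ->
  P (A `&` D n @^-1` [set k] `&` D n.+1 @^-1` [set k]) = 0%E.
Proof.
move=> FA; have mD i B : measurable (D i @^-1` B).
  by apply: (@history_measurable i); exact: history_direction.
have mA : measurable (A `&` D n @^-1` [set k]).
  by apply: measurableI => //; exact: history_measurable FA.
have := measure_fin_partition P mA (fun k => mD n.+1 [set k]).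
rewrite (bigD1 k)//= (eq_bigr (fun=> ((3^-1)%:E * P (A `&` D n @^-1` [set k]))%E)).
  have PAf : P (A `&` D n @^-1` [set k]) \is a fin_num by rewrite fin_num_measure.
  rewrite big_const (_ : #|_| = 3%N); last by have := cardC1 k; rewrite card_ord.
  rewrite /= -(fineK PAf); set x := fine _; set y := P _.
  have : y \is a fin_num by rewrite fin_num_measure//; apply: measurableI.
  case: y => // y _ /(congr1 fine) /= e; congr EFin.
  by move: e; rewrite -/x; lra.
by move=> j jk; exact: (direction_switch XY).
Qed.

(** The pair [(false, false)], no change of direction, has probability [0]. *)
Definition flip_weight (f : bool * bool) : R := if f == (false, false) then 0 else 3^-1.

Lemma flips_law n f A : history n A ->
  P (A `&` flips n @^-1` [set f]) = ((flip_weight f)%:E * P A)%E.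
Proof.
move=> FA; have mA := history_measurable FA.
have mD i B : measurable (D i @^-1` B).
  by apply: (@history_measurable i); exact: history_direction.
have mf : measurable (flips n @^-1` [set f]).
  by apply: (@history_measurable n.+1); exact: flips_discrete.
rewrite (measure_fin_partition P (measurableI _ _ mA mf) (fun k => mD n [set k])).
rewrite [in RHS](measure_fin_partition P mA (fun k => mD n [set k])).
rewrite ge0_sume_distrr//; apply: eq_bigr => k _.
rewrite (_ : _ `&` _ = A `&` D n @^-1` [set k] `&` D n.+1 @^-1` [set turn k f]); last first.
  apply/seteqP; split => w /=.
    by move=> [[Aw /flipsE e] kw]; rewrite -kw.
  by move=> [[Aw kw] e]; split => //; split => //; apply/flipsE; rewrite kw.
rewrite /flip_weight; case: ifPn => [f0|f0].
  have /eqP -> : turn k f == k by rewrite turnE.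
  by rewrite direction_switch_self// mul0e.
by rewrite (direction_switch XY)// turnE.
Qed.

Definition reversal_weight (b : bool) : R := if b then 2 / 3 else 3^-1.

(** A function of the flips has the image law; it is used for the two
    projections, whose weights are [reversal_weight]. *)
Lemma flips_image_law n (f : bool * bool -> bool) b A : history n A ->
  \sum_(x | f x == b) flip_weight x = reversal_weight b ->
  P (A `&` (fun w => f (flips n w)) @^-1` [set b]) = ((reversal_weight b)%:E * P A)%E.
Proof.
move=> FA <-; have mA := history_measurable FA.
have mf B : measurable (flips n @^-1` B).
  by apply: (@history_measurable n.+1); exact: flips_discrete.
rewrite (measure_fin_partition P (Z := flips n)); last 2 first.
- by apply: measurableI => //; exact: (mf (f @^-1` [set b])).
- by move=> x; exact: mf.
rewrite -sumEFin ge0_sume_distrl; last first.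
  by move=> x _; rewrite lee_fin /flip_weight; case: ifP.
rewrite [RHS]big_mkcond/=; apply: eq_bigr => x _; case: ifPn => [/eqP fx|fx].
  rewrite -(flips_law _ FA); congr (P _).
  apply/seteqP; split => w /=; first by move=> [[]].
  by move=> [Aw e]; rewrite -fx -e.
rewrite (_ : _ `&` _ = set0) ?measure0//; apply/seteqP; split => // w [[_ /= fw] e].
by move: fx; rewrite -fw -e eqxx.
Qed.

Lemma fst_flips_law n b A : history n A ->
  P (A `&` (fun w => (flips n w).1) @^-1` [set b]) = ((reversal_weight b)%:E * P A)%E.
Proof.
move=> FA; apply: flips_image_law => //; rewrite big_mkcond/=.
rewrite -(pair_bigA _ (fun x y => if x == b then flip_weight (x, y) else 0))/=.
by rewrite !big_bool /flip_weight /reversal_weight !xpair_eqE; case: b => /=; field.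
Qed.

Lemma snd_flips_law n b A : history n A ->
  P (A `&` (fun w => (flips n w).2) @^-1` [set b]) = ((reversal_weight b)%:E * P A)%E.
Proof.
move=> FA; apply: flips_image_law => //; rewrite big_mkcond/=.
rewrite -(pair_bigA _ (fun x y => if y == b then flip_weight (x, y) else 0))/=.
by rewrite !big_bool /flip_weight /reversal_weight !xpair_eqE; case: b => /=; field.
Qed.

(** Each sign occurs for two of the four directions. *)
Lemma initial_law (f : 'I_4 -> bool) b : #|[pred k | f k == b]| = 2%N ->
  P [set w | f (D 0%N w) = b] = (2^-1)%:E.
Proof.
move=> f2; have mD B : measurable (D 0%N @^-1` B).
  by rewrite -[_ @^-1` _]setTI; exact: (direction_measurable XY).
rewrite (measure_fin_partition P (mD [set k | f k = b]) (fun k => mD [set k])).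
rewrite (eq_bigr (fun k => if f k == b then (4^-1)%:E else 0%E)).
  rewrite -big_mkcond sumEFin sumr_const f2; congr EFin; rewrite -mulr_natl.
  by field.
move=> k _; case: eqP => fk.
  rewrite -(direction_initial XY k); congr (P _).
  by apply/seteqP; split => w /=; [case|move=> ->].
rewrite (_ : _ `&` _ = set0) ?measure0//.
by apply/seteqP; split => // w /= [fw e]; apply: fk; rewrite -e.
Qed.

End Motion.

(** * One coordinate is a telegraph process *)

Lemma independent_pair d (T : measurableType d) (R : realType)
    (P : probability T R) (F G : set_system T) :
  mutually_independent P (tnth [tuple F; G]) ->
  forall A B, F A -> G B -> P (A `&` B) = (P A * P B)%E.
Proof.
move=> ind A B FA GB.
have := ind [set: 'I_2]%SET (tnth [tuple A; B]).
rewrite (eq_bigl xpredT); last by move=> i; rewrite inE.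
rewrite big_ord_recl big_ord1 /= (_ : \bigcap_(i in _) _ = A `&` B); last first.
  apply/seteqP; split => w /=.
    move=> H; split; first by apply: (H ord0); rewrite /= inE.
    by apply: (H (lift ord0 ord0)); rewrite /= inE.
  move=> [Aw Bw] i _; case: i => [[|[|//]]] i.
    by rewrite (tnth_nth A).
  by rewrite (tnth_nth A).
by move=> -> // i _; case: i => [[|[|//]]] i; rewrite !(tnth_nth A, tnth_nth F).
Qed.

Section Coordinate.
Context d (T : measurableType d) (R : realType) (P : probability T R).
Context (c : R) (lam : R -> R) (N : R -> T -> nat) (D : nat -> T -> 'I_4).
Context (X Y : R -> T -> R).
Hypothesis lam_C1 : C1_nonneg_rate lam.
Hypothesis lam_int : forall t, 0 < t ->
  (\int[lebesgue_measure]_(s in `]0%R, t]) (lam s)%:E < +oo)%E.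
Hypothesis HN : poisson_process P lam N.
Hypothesis XY : reflecting_motion P c N D X Y.

Lemma initial_setT : sigma_var (D 0%N) setT.
Proof. by exists setT => //; rewrite setTI. Qed.

Lemma initial_setI : setI_closed (sigma_var (D 0%N)).
Proof.
by move=> _ _ [B _ <-] [B' _ <-]; exists (B `&` B') => //; rewrite !setTI preimage_setI.
Qed.

Lemma initial_history : sigma_var (D 0%N) `<=` history N D 0.
Proof. by move=> _ [B _ <-]; rewrite setTI; exact: history_direction. Qed.

Lemma initial_independent E A : sigma_var (D 0%N) E -> sigma_process N A ->
  P (E `&` A) = (P E * P A)%E.
Proof.
by have ind := independent_pair (direction_initial_indep XY); exact: ind.
Qed.

Section Colouring.
Context (K : finType) (C : nat -> T -> K) (p : K -> R).
Hypothesis CF : forall n, discrete_variable (history N D n.+1) (C n).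
Hypothesis PC : forall n k A, history N D n A ->
  P (A `&` C n @^-1` [set k]) = ((p k)%:E * P A)%E.

Lemma motion_coloured_independent : mutually_independent P (fun o : option K =>
  if o is Some k then sigma_process (coloured C N k) else sigma_var (D 0%N)).
Proof.
apply: (@thinning_independent _ _ _ P K (history N D) C p) HN _ _ _ _ _ _.
- exact: sigma_algebra_history.
- exact: (history_measurable XY (poisson_measurable HN)).
- exact: historyS.
- by move=> n k; exact: CF.
- exact: PC.
- by move=> s t; exact: cumulative_rate_ge0.
- by move=> t; exact: history_count.
- exact: initial_history.
- exact: initial_independent.
- exact: initial_setT.
- exact: initial_setI.
Qed.

Lemma motion_coloured_poisson k (mu : R -> R) : mu = (fun t => p k * lam t) ->
  poisson_process P mu (coloured C N k).
Proof.
move=> ->.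
apply: (@thinning_poisson _ _ _ P K (history N D) C p _ _ _ _ _ lam N (sigma_var (D 0%N))).
- exact: sigma_algebra_history.
- exact: (history_measurable XY (poisson_measurable HN)).
- exact: historyS.
- by move=> n l; exact: CF.
- exact: PC.
- exact: HN.
- by move=> s t; exact: cumulative_rate_ge0.
- by move=> t; exact: history_count.
- exact: initial_history.
- exact: initial_independent.
- exact: initial_setT.
- by move=> s t s0 _; exact: cumulative_rateZ.
Qed.

End Colouring.

Section Reversals.
Context (neg : 'I_4 -> bool) (Z : R -> T -> R).
Definition reverses n w := neg (D n w) (+) neg (D n.+1 w).
Definition reversals t w := coloured reverses N true t w.

Hypothesis c_gt0 : 0 < c.
Hypothesis reverses_law : forall n b A, history N D n A ->
  P (A `&` reverses n @^-1` [set b]) = ((reversal_weight R b)%:E * P A)%E.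
Hypothesis neg_half : forall b, P [set w | neg (D 0%N w) = b] = (2^-1)%:E.
Hypothesis ZE : forall t w, 0 <= t -> Z t w =
  \int[lebesgue_measure]_(s in `[0, t]) (c / 2 * (-1) ^+ neg (D (N s w) w)).

Lemma reverses_discrete n : discrete_variable (history N D n.+1) (reverses n).
Proof.
apply: (discrete_variable_comp (fun x => neg x.1 (+) neg x.2)
  (Z := fun w => (D n w, D n.+1 w))).
by apply: discrete_variable_pair; [exact: sigma_algebra_history|exact: history_direction..].
Qed.

(** The sign is the initial one flipped once per reversal. *)
Lemma neg_reversals n w :
  neg (D n w) = neg (D 0%N w) (+) odd (colour_count reverses true n w).
Proof.
elim: n => [|n IH]; first by rewrite /colour_count big_ord0 addbF.
rewrite colour_countS oddD addbA -IH /reverses.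
by case: (neg (D n w)) (neg (D n.+1 w)) => -[].
Qed.

Lemma reversals_poisson : poisson_process P (fun t => 2 * lam t / 3) reversals.
Proof.
apply: (motion_coloured_poisson reverses_discrete reverses_law (k := true)).
by apply/funext => t; rewrite /reversal_weight mulrAC.
Qed.

Definition initial_velocity w : R := c / 2 * (-1) ^+ neg (D 0%N w).

Lemma initial_velocity_measurable : measurable_fun setT initial_velocity.
Proof.
apply: (measurableT_comp (f := fun k => c / 2 * (-1) ^+ neg k)) => //.
exact: (direction_measurable XY).
Qed.

(** The two velocities differ because [c] is positive. *)
Lemma initial_velocityE (b : bool) :
  initial_velocity @^-1` [set c / 2 * (-1) ^+ b] = [set w | neg (D 0%N w) = b].
Proof.
apply/seteqP; split => w /=; rewrite /initial_velocity; last by move=> ->.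
by case: (neg _) b => -[] //; rewrite ?expr1 ?expr0; have := c_gt0; lra.
Qed.

Lemma reversals_independent : mutually_independent P
  (tnth [tuple sigma_var initial_velocity; sigma_process reversals]).
Proof.
apply: (mutually_independent_inj (h := tnth [tuple None; Some true]) _ _
  (motion_coloured_independent reverses_discrete reverses_law)).
  by move=> [[|[|//]] i] [[|[|//]] j] // _; apply: val_inj.
move=> [[|[|//]] i]; rewrite !(tnth_nth None) !(tnth_nth set0) /=.
  move=> _ [B mB <-]; rewrite setTI.
  by exists ((fun k => c / 2 * (-1) ^+ neg k) @^-1` B) => //; rewrite setTI.
by [].
Qed.

Lemma coordinate_telegraph :
  telegraph_process P (c / 2) (fun t => 2 * lam t / 3) reversals Z.
Proof.
split; first exact: reversals_poisson.
exists initial_velocity; split.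
- exact: initial_velocity_measurable.
- have := initial_velocityE false; rewrite expr0 mulr1 => ->.
  have := initial_velocityE true; rewrite expr1 mulrN1 => ->.
  by rewrite !neg_half.
- exact: reversals_independent.
- move=> t w t0; rewrite ZE//; apply: eq_Rintegral => s _.
  by rewrite neg_reversals signr_addb signr_odd mulrA.
Qed.

(** The coordinate has moved at full speed in the positive direction up to [t]. *)
Definition top_event t := [set w | Z t w = c / 2 * t].

Lemma top_eventE t : 0 < t -> top_event t =
  [set w | forall s, 0 <= s < t -> neg (D (N s w) w) = false].
Proof.
move=> t0; have c2 : 0 < c / 2 by rewrite divr_gt0.
apply/seteqP; split => w /=; rewrite /top_event /= ZE ?ltW//;
  have /= := @path_integral_top R (N ^~ w) (poisson_nondecreasing HN w)
    (c / 2) (fun n => neg (D n w)) c2 (fun s s0 => (discrete_right_limit _ _ _).1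
       (poisson_right_continuous HN (w := w) s0)) t t0; by move=> [].
Qed.

Lemma neg_measurable s : 0 <= s -> measurable [set w | neg (D (N s w) w) = false].
Proof.
move=> s0; have dD : discrete_variable measurable (fun w => D (N s w) w).
  apply: (discrete_variable_index (sigma_algebra_measurable T)
    (M := N s) (Z := fun n w => D n w)).
    by move=> B; rewrite -[_ @^-1` _]setTI; exact: (poisson_measurable HN).
  by move=> n B; rewrite -[_ @^-1` _]setTI; exact: (direction_measurable XY).
exact: (dD [set k | neg k = false]).
Qed.

(** By right continuity it is enough to look at the rational times before [t]. *)
Lemma top_event_measurable t : 0 < t -> measurable (top_event t).
Proof.
move=> t0; rewrite top_eventE// -[X in measurable X]setCK; apply: measurableC.
rewrite (_ : ~` _ = \bigcup_(q in [set q : rat | 0 <= (ratr q : R) < t])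
    ~` [set w | neg (D (N (ratr q) w) w) = false]).
  apply: (sigma_algebra_countable_cup (sigma_algebra_measurable T)) => q /= /andP[q0 _].
  by apply: measurableC; exact: neg_measurable.
apply/seteqP; split => w /=.
  move=> /existsNP[s /not_implyP[/andP[s0 st] ns]].
  have [e /= e0 He] := (discrete_right_limit _ _ _).1 (poisson_right_continuous HN (w := w) s0).
  have : s < Num.min (s + e) t by rewrite lt_min st ltrDl e0.
  move=> /rat_in_itvoo[q]; rewrite in_itv/= lt_min => /and3P[sq qe qt].
  exists q; first by rewrite /= (le_trans s0 (ltW sq)).
  rewrite /= (_ : N (ratr q) w = N s w)//; apply: (He (ratr q)) => //=.
  by rewrite ltr0_norm ?subr_lt0//; lra.
by move=> [q /= q0t nq] H; apply: nq; exact: H.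
Qed.

(** The sign at time [s] is positive on the top event, so the number of reversals
    up to [s] is even; it is enough to exclude the value [1].  The variable [m] is
    the expected number of reversals up to [s]. *)
Lemma top_event_le s t m : 0 <= s -> s < t ->
  m = 2 / 3 * cumulative_rate lam 0 s ->
  (P (top_event t) <= (2^-1 * (1 - m * expR (- m)))%:E)%E.
Proof.
move=> s0 st mE; have t0 := le_lt_trans s0 st.
have mu_m : cumulative_rate (fun t => 2 * lam t / 3) 0 s = m.
  rewrite mE -cumulative_rateZ//; congr cumulative_rate.
  by apply/funext => u; rewrite mulrAC.
have m0 : 0 <= m by rewrite mE mulr_ge0// cumulative_rate_ge0.
have P1 : P (reversals s @^-1` [set 1%N]) = (m * expR (- m))%:E.
  have := poisson_law_increments reversals_poisson [set 1%N] (lexx 0) s0.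
  rewrite mu_m poisson_prob1// expr1 (_ : 1`! = 1)%N// divr1 => <-; congr (P _).
  by apply/seteqP; split => w /=; rewrite (poisson_start reversals_poisson) subn0.
have m1 : measurable (reversals s @^-1` [set 1%N]).
  by rewrite -[_ @^-1` _]setTI; exact: (poisson_measurable reversals_poisson).
have mneg : measurable [set w | neg (D 0%N w) = false].
  have := neg_measurable (lexx 0).
  by under eq_set do rewrite (poisson_start HN).
(* The bound is the probability of a positive start and a number of reversals
   other than 1, two independent events. *)
have -> : (2^-1 * (1 - m * expR (- m)))%:E =
    P ([set w | neg (D 0%N w) = false] `&` ~` (reversals s @^-1` [set 1%N])).
  rewrite (independent_pair reversals_independent).
  - have -> : P (~` (reversals s @^-1` [set 1%N])) = (1 - (m * expR (- m))%:E)%E.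
      by rewrite probability_setC// P1.
    by rewrite neg_half.
  - by rewrite -initial_velocityE; exists [set c / 2 * (-1) ^+ false] => //; rewrite setTI.
  - rewrite preimage_setC; exact: sigma_process_variable.
apply: le_measure; rewrite ?inE.
- exact: top_event_measurable.
- by apply: measurableI => //; exact: measurableC.
rewrite top_eventE// => w /= H.
have n0 : neg (D 0%N w) = false.
  by have := H 0; rewrite (poisson_start HN) lexx t0; exact.
split=> // r1; have := H s; rewrite s0 st => /(_ isT).
rewrite neg_reversals n0 /=; have := r1; rewrite /reversals /coloured => ->.
by [].
Qed.

Lemma top_event_no_jump t : 0 < t ->
  [set w | neg (D 0%N w) = false] `&` N t @^-1` [set 0%N] `<=` top_event t.
Proof.
move=> t0; rewrite top_eventE// => w [/= n0 Nt] s /andP[s0 st].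
have := poisson_nondecreasing HN w s0 (ltW st).
by rewrite Nt leqn0 => /eqP ->.
Qed.

End Reversals.
End Coordinate.

(** * The two coordinates together *)

Section Coordinates.
Context d (T : measurableType d) (R : realType) (P : probability T R).
Context (c : R) (lam : R -> R) (N : R -> T -> nat) (D : nat -> T -> 'I_4).
Context (X Y : R -> T -> R).
Hypothesis c_gt0 : 0 < c.
Hypothesis lam_C1 : C1_nonneg_rate lam.
Hypothesis lam_int : forall t, 0 < t ->
  (\int[lebesgue_measure]_(s in `]0%R, t]) (lam s)%:E < +oo)%E.
Hypothesis HN : poisson_process P lam N.
Hypothesis XY : reflecting_motion P c N D X Y.

Let mN := poisson_measurable HN.

(** The two coordinates are the cases [e = 1] and [e = -1]. *)
Lemma motion_half (e : R) (neg : 'I_4 -> bool) t w :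
  (forall k, (direction R k).1 + e * (direction R k).2 = (-1) ^+ neg k) ->
  0 <= t -> (X t w + e * Y t w) / 2 =
  \int[lebesgue_measure]_(s in `[0, t]) (c / 2 * (-1) ^+ neg (D (N s w) w)).
Proof.
move=> dirE t0; rewrite (motion_abscissa XY)// (motion_ordinate XY)//.
have int1 (g : 'I_4 -> R) : (@lebesgue_measure R).-integrable `[0, t]
    (EFin \o (fun s => g (D (N s w) w))).
  exact: (counting_path_integrable (poisson_nondecreasing HN w) (fun n => g (D n w))).
rewrite -RintegralZl//; last exact: (int1 (fun k => c * (direction R k).2)).
rewrite -RintegralD//; last 2 first.
- exact: (int1 (fun k => c * (direction R k).1)).
- exact: (int1 (fun k => e * (c * (direction R k).2))).
rewrite -RintegralZr//; last first.
  exact: (int1 (fun k => c * (direction R k).1 + e * (c * (direction R k).2))).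
by apply: eq_Rintegral => s _; rewrite -dirE; field.
Qed.

Lemma half_sumE t w : 0 <= t -> (X t w + Y t w) / 2 =
  \int[lebesgue_measure]_(s in `[0, t]) (c / 2 * (-1) ^+ negU (D (N s w) w)).
Proof.
move=> t0; rewrite -(motion_half (e := 1))// ?mul1r// => k.
by rewrite mul1r directionU.
Qed.

Lemma half_diffE t w : 0 <= t -> (X t w - Y t w) / 2 =
  \int[lebesgue_measure]_(s in `[0, t]) (c / 2 * (-1) ^+ negV (D (N s w) w)).
Proof.
move=> t0; rewrite -(motion_half (e := -1))// ?mulN1r// => k.
by rewrite mulN1r directionV.
Qed.

Lemma negU_half b : P [set w | negU (D 0%N w) = b] = (2^-1)%:E.
Proof.
apply: (initial_law XY); rewrite -sum1_card big_mkcond/= !big_ord_recl big_ord0.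
by case: b.
Qed.

Lemma negV_half b : P [set w | negV (D 0%N w) = b] = (2^-1)%:E.
Proof.
apply: (initial_law XY); rewrite -sum1_card big_mkcond/= !big_ord_recl big_ord0.
by case: b.
Qed.

Lemma count_fst n w : colour_count (reverses D negU) true n w =
  (colour_count (flips D) (true, false) n w + colour_count (flips D) (true, true) n w)%N.
Proof.
rewrite -big_split; apply: eq_bigr => i _ /=; rewrite !xpair_eqE.
by rewrite /reverses; case: (_ (+) _) (_ (+) _) => -[].
Qed.

Lemma count_snd n w : colour_count (reverses D negV) true n w =
  (colour_count (flips D) (false, true) n w + colour_count (flips D) (true, true) n w)%N.
Proof.
rewrite -big_split; apply: eq_bigr => i _ /=; rewrite !xpair_eqE.
by rewrite /reverses; case: (negU _ (+) _) (_ (+) _) => -[].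
Qed.

(** Off the countable union of the null events that the [n]-th switch changes
    nothing, the fourth colour does not occur. *)
Lemma flips_total : {ae P, forall w, forall t, 0 <= t -> N t w =
  (coloured (flips D) N (true, false) t w + coloured (flips D) N (false, true) t w
   + coloured (flips D) N (true, true) t w)%N}.
Proof.
have null n : P.-negligible (flips D n @^-1` [set (false, false)]).
  have HT : history N D n setT.
    by rewrite -[setT]setD0; have [H0 HC _] := sigma_algebra_history N D n; exact: HC.
  have mf : measurable (flips D n @^-1` [set (false, false)]).
    by apply: (history_measurable XY mN (n := n.+1)); exact: flips_discrete.
  exists (flips D n @^-1` [set (false, false)]); split => //.
  by have := flips_law XY mN (false, false) HT; rewrite setTI mul0e.
apply: negligibleS (negligible_bigcup null) => w /= /existsNP[t /not_implyP[t0 Nt]].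
apply: contrapT => Nw; apply: Nt; rewrite -(sum_coloured (flips D) N t w).
have c0 : coloured (flips D) N (false, false) t w = 0%N.
  rewrite /coloured /colour_count big1// => i _; case: eqP => // e.
  by case: Nw; exists (i : nat).
rewrite -(pair_bigA _ (fun x y => coloured (flips D) N (x, y) t w))/=.
rewrite !big_bool c0 /= [RHS]addnC [RHS]addnA [LHS]addnA; exact: addn0.
Qed.

(** Since [exp (- m)] is at least [1 - m], the first bound is at most
    [1 - m + m ^+ 2]; as [3 / 5] exceeds [1 / 2] and [eta] is small, this is below
    [1 - eta / 2], hence below [exp (- (eta / 2))]. *)
Lemma small_rate_estimate (m eta : R) : 0 < eta -> eta <= 3 / 20 -> m = 3 / 5 * eta ->
  0 <= 1 - m * expR (- m) < expR (- (eta / 2)).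
Proof.
move=> eta0 eta1 mE.
have em : 1 - m <= expR (- m) by exact: expR_ge1Dx.
have e2 : 1 - eta / 2 <= expR (- (eta / 2)) by exact: expR_ge1Dx.
have em1 : expR (- m) <= 1 by rewrite -expR0 ler_expR; lra.
have m0 : 0 < m by lra.
apply/andP; split; first by nra.
rewrite (lt_le_trans _ e2)//.
have : m * (1 - m) <= m * expR (- m) by rewrite ler_pM2l.
nra.
Qed.

(** The time [t] is chosen with small cumulative rate [eta] and then [s < t] with
    [9 / 10] of it, so that [m = 3 / 5 * eta] is the expected number of reversals
    of each coordinate up to [s].  The square of the resulting bound on the
    probability of each top event is smaller than [exp (- eta) / 4], a lower bound
    on the probability of both. *)
Lemma coordinates_dependent (U V : R -> T -> R) :
  (forall t w, 0 <= t -> U t w =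
    \int[lebesgue_measure]_(s in `[0, t]) (c / 2 * (-1) ^+ negU (D (N s w) w))) ->
  (forall t w, 0 <= t -> V t w =
    \int[lebesgue_measure]_(s in `[0, t]) (c / 2 * (-1) ^+ negV (D (N s w) w))) ->
  (exists2 t, 0 < t & lam t != 0) ->
  ~ mutually_independent P (tnth [tuple sigma_process U; sigma_process V]).
Proof.
move=> UE VE [t0 t0_gt0 lt0] ind.
have L0 := cumulative_rate_gt0 lam_C1 lam_int t0_gt0 lt0.
pose eta := Num.min (cumulative_rate lam 0 t0) (3 / 20).
have eta0 : 0 < eta by rewrite lt_min L0/=; lra.
have eta1 : eta <= 3 / 20 by rewrite ge_min lexx orbT.
have [|t /andP[t_ge0 _] Lt] := cumulative_rate_IVT lam_C1 lam_int t0_gt0 (v := eta).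
  by rewrite ltW//= ge_min lexx.
have t_gt0 : 0 < t.
  rewrite lt_neqAle t_ge0 andbT; apply/eqP => t00.
  by move: Lt; rewrite -t00 cumulative_rate0; lra.
have [|s /andP[s0 st] Ls] := cumulative_rate_IVT lam_C1 lam_int t_gt0 (v := 9 / 10 * eta).
  by rewrite Lt; apply/andP; split; lra.
have s_lt_t : s < t.
  rewrite lt_neqAle st andbT; apply/eqP => e.
  by move: Ls; rewrite e Lt; lra.
pose m := 3 / 5 * eta.
have mE : m = 2 / 3 * cumulative_rate lam 0 s by rewrite Ls /m; lra.
pose q := 2^-1 * (1 - m * expR (- m)).
have PU : (P (top_event c U t) <= q%:E)%E.
  exact: (top_event_le lam_C1 lam_int HN XY c_gt0 (fst_flips_law XY mN) negU_half UE s0 s_lt_t mE).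
have PV : (P (top_event c V t) <= q%:E)%E.
  exact: (top_event_le lam_C1 lam_int HN XY c_gt0 (snd_flips_law XY mN) negV_half VE s0 s_lt_t mE).
have mU := top_event_measurable HN XY c_gt0 UE t_gt0.
have mV := top_event_measurable HN XY c_gt0 VE t_gt0.
have top_sigma (W : R -> T -> R) : sigma_process W (top_event c W t).
  apply: sub_sigma_algebra; exists t => //; exists [set c / 2 * t] => //.
  by rewrite setTI.
have PUV : P (top_event c U t `&` top_event c V t) =
    (P (top_event c U t) * P (top_event c V t))%E.
  exact: (independent_pair ind).
have low : ((4^-1 * expR (- eta))%:E <= P (top_event c U t `&` top_event c V t))%E.
  have -> : ((4^-1 * expR (- eta))%:E =
      P (D 0%N @^-1` [set ord0] `&` N t @^-1` [set 0%N]))%E.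
    rewrite (initial_independent XY).
    - rewrite (direction_initial XY) EFinM; congr (_ * _)%E.
      have := poisson_law_increments HN [set 0%N] (lexx 0) t_ge0.
      rewrite Lt poisson_prob1 ?ltW// expr0 fact0 divr1 mul1r => <-; congr (P _).
      by apply/seteqP; split => w /=; rewrite (poisson_start HN) subn0.
    - by exists [set ord0] => //; rewrite setTI.
    - exact: sigma_process_variable.
  apply: le_measure; rewrite ?inE.
  - apply: measurableI; rewrite -[_ @^-1` _]setTI; [exact: (direction_measurable XY)|exact: mN].
  - exact: measurableI.
  move=> w [/= D0 N0]; split.
    by apply: (top_event_no_jump HN c_gt0 UE t_gt0); split; rewrite //= D0.
  by apply: (top_event_no_jump HN c_gt0 VE t_gt0); split; rewrite //= D0.
have /andP[q0 q1] := small_rate_estimate eta0 eta1 (erefl m).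
have : ((4^-1 * expR (- eta))%:E <= (q * q)%:E)%E.
  by rewrite (le_trans low)// PUV EFinM lee_pmul.
rewrite lee_fin leNgt => /negP; apply.
rewrite (_ : - eta = - (eta / 2) + - (eta / 2)); last by field.
rewrite expRD /q; nra.
Qed.

End Coordinates.

Theorem mainTheorem9 (R : realType) (d : measure_display)
    (T : measurableType d) (P : probability T R) (c : R) (lam : R -> R)
    (N : R -> T -> nat) (D : nat -> T -> 'I_4) (X Y : R -> T -> R)
    (c_gt0 : 0 < c) (lam_C1 : C1_nonneg_rate lam)
    (lam_int : forall t, 0 < t ->
      (\int[lebesgue_measure]_(s in `]0%R, t]) (lam s)%:E < +oo)%E)
    (N_poisson : poisson_process P lam N)
    (XY_motion : reflecting_motion P c N D X Y) :
  let U := fun (t : R) (w : T) => (X t w + Y t w) / 2 in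
  let V := fun (t : R) (w : T) => (X t w - Y t w) / 2 in
  (exists NU NV Nt : R -> T -> nat,
    [/\ [/\ poisson_process P (fun t => lam t / 3) NU,
            poisson_process P (fun t => lam t / 3) NV &
            poisson_process P (fun t => lam t / 3) Nt],
        mutually_independent P
          (tnth [tuple sigma_process NU; sigma_process NV; sigma_process Nt]),
        telegraph_process P (c / 2) (fun t => 2 * lam t / 3)
          (fun t w => (NU t w + Nt t w)%N) U,
        telegraph_process P (c / 2) (fun t => 2 * lam t / 3)
          (fun t w => (NV t w + Nt t w)%N) V &
        {ae P, forall w, forall t, 0 <= t ->
          N t w = (NU t w + NV t w + Nt t w)%N}]) /\
  ((exists2 t, 0 < t & lam t != 0) ->
    ~ mutually_independent P (tnth [tuple sigma_process U; sigma_process V])).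
Proof.
move=> U V; have mN := poisson_measurable N_poisson.
have UE t w := @half_sumE _ _ _ _ _ _ _ _ _ _ N_poisson XY_motion t w.
have VE t w := @half_diffE _ _ _ _ _ _ _ _ _ _ N_poisson XY_motion t w.
split; last first.
  exact: (coordinates_dependent c_gt0 lam_C1 lam_int N_poisson XY_motion UE VE).
pose Nk := coloured (flips D) N.
have poissonk k : k != (false, false) -> poisson_process P (fun t => lam t / 3) (Nk k).
  move=> k0; apply: (motion_coloured_poisson lam_C1 lam_int N_poisson XY_motion
    (flips_discrete (N := N) (D := D)) (flips_law XY_motion mN)).
  by apply/funext => t; rewrite /flip_weight (negPf k0) mulrC.
exists (Nk (true, false)), (Nk (false, true)), (Nk (true, true)); split.
- by split; exact: poissonk.
- have ind := motion_coloured_independent lam_C1 N_poisson XY_motion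
    (flips_discrete (N := N) (D := D)) (flips_law XY_motion mN).
  pose h : 'I_3 -> option (bool * bool) :=
    tnth [tuple Some (true, false); Some (false, true); Some (true, true)].
  have h_inj : injective h.
    by move=> [[|[|[|//]]] i] [[|[|[|//]]] j] // _; apply: val_inj.
  apply: mutually_independent_inj h_inj _ ind.
  by move=> [[|[|[|//]]] i]; rewrite /h !(tnth_nth None) !(tnth_nth set0) /=.
- have := coordinate_telegraph lam_C1 lam_int N_poisson XY_motion c_gt0
    (fst_flips_law XY_motion mN) (negU_half XY_motion) UE.
  by congr telegraph_process; apply/funext => t; apply/funext => w; exact: count_fst.
- have := coordinate_telegraph lam_C1 lam_int N_poisson XY_motion c_gt0
    (snd_flips_law XY_motion mN) (negV_half XY_motion) VE.
  by congr telegraph_process; apply/funext => t; apply/funext => w; exact: count_snd.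
- exact: (flips_total N_poisson XY_motion).
Qed.
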